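(* Let $n\in\mathbb{N}$ and let the probability measures $\mu_1,\dots,\mu_n$ on $\mathbb{R}$ satisfy Assumption A (stated in the context). Then the following implications hold. For $y\ge0$, $$M_n>\xi_n(y)\ \Longrightarrow\ \bar M_n\ge y,$$ $$M_n\ge\xi_n(y)\ \Longrightarrow\ \bar M_n\ge y\quad\text{if }\xi_n\text{ is strictly increasing at }y.$$ For $y\ge0$ such that $\jmath_n(y)\ne0$, $$M_{\jmath_n(y)}\ge\xi_n(y)>\xi_{\jmath_n(y)}(y)\ \Longrightarrow\ M_n\ge\xi_n(y),$$ $$\bar M_{\jmath_n(y)}<y,\ \bar M_n\ge y\ \Longrightarrow\ M_n\ge\xi_n(y),$$ $$\bar M_{\jmath_n(y)}\ge y,\ M_{\jmath_n(y)}<\xi_n(y)\ \Longrightarrow\ M_n<\xi_n(y).$$ If $\xi_n$ is strictly increasing at $y\ge0$ and $\jmath_n(y)=0$, then $$M_n\ge\xi_n(y)\ \Longleftrightarrow\ \bar M_n\ge y.$$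
   Context: Process. $(\Omega,\mathcal{F},\mathbb{F}=(\mathcal{F}_t),\mathbb{P})$ is a filtered probability space satisfying the usual hypotheses, $B$ is a continuous $\mathbb{F}$-local martingale with $B_0=0$, $\langle B\rangle_\infty=\infty$ a.s., and $B$ has no intervals of constancy a.s. Put $\bar B_t:=\sup_{s\le t}B_s$. Calls and endpoints. For probability measures $\mu_1,\dots,\mu_n$ on $\mathbb{R}$ put $c_i(\zeta):=\int_{\mathbb{R}}(x-\zeta)^+\mu_i(dx)$, $\zeta\in\mathbb{R}$; $r_{\mu_i}:=\inf\{x:\mu_i((x,\infty))=0\}$ and $l_{\mu_i}:=\sup\{x:\mu_i([x,\infty))=1\}$ are the right and left endpoints of the support of $\mu_i$. Conventions: $c_0\equiv0$, $K_0\equiv0$, $\xi_0\equiv-\infty$. $f(x-)$, $f(x+)$ denote left and right limits; $c_i'(y-)$ is the left limit at $y$ of the derivative (the left derivative). Recursive definition of $\imath_i,\xi_i,\jmath_i,K_i$ ($i=1,\dots,n$). Let $y\ge0$ and suppose $\xi_k,K_k$ are defined for $k<i$. For $\zeta\le y$ let $$\imath_i(\zeta;y):=\max\{k\in\{0,1,\dots,i-1\}:\xi_k(y)<\zeta\},$$ $$c^i(\zeta,y):=c_i(\zeta)-\left[c_{\imath_i(\zeta;y)}(\zeta)-(y-\zeta)K_{\imath_i(\zeta;y)}(y)\right].$$ Define $$\xi_i(y):=\sup\left\{\arg\inf_{\zeta<y}\frac{c^i(\zeta,y)}{y-\zeta}\right\},\qquad \jmath_i(y):=\imath_i(\xi_i(y);y),\qquad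 K_i(y):=\frac{c^i(\xi_i(y),y)}{y-\xi_i(y)}.$$ The objective $\zeta\mapsto\frac{c^i(\zeta,y)}{y-\zeta}$ is extended to $\zeta=y$ by its left limit, i.e. by $-c_i'(y-)+c'_{\imath_i(y;y)}(y-)+K_{\imath_i(y;y)}(y)$ if $c_i(y)=c_{\imath_i(y;y)}(y)$ and by $+\infty$ otherwise, and to $\zeta=l_{\mu_i}$ by $\frac{-l_{\mu_i}}{y-l_{\mu_i}}$ if $l_{\mu_i}>-\infty$ and by $1$ if $l_{\mu_i}=-\infty$; $\xi_i(y)$ is equivalently a minimizer of this extended objective over $\zeta\le y$, and $K_i(y)$ is the value of the extended objective at $\xi_i(y)$ (also when $\xi_i(y)=y$, or when $y=0$ and $\xi_i(0)=l_{\mu_i}=-\infty$). Embedding. $\tau_0\equiv0$ and for $i=1,\dots,n$: $\tau_i:=\inf\{t\ge\tau_{i-1}:B_t\le\xi_i(\bar B_t)\}$ if $B_{\tau_{i-1}}>\xi_i(\bar B_{\tau_{i-1}})$, and $\tau_i:=\tau_{i-1}$ otherwise. Write $M_0:=0$, $M_i:=B_{\tau_i}$ and $\bar M_i:=\bar B_{\tau_i}$ for $i=0,1,\dots,n$. ''$\xi_n$ is strictly increasing at $y$'' means $\xi_n(y')<\xi_n(y)<\xi_n(y'')$ for all $0\le y'<y<y''$. Assumption A (on $\mu_1,\dots,\mu_n$). (i) $\int|x|\mu_i(dx)<\infty$, $\int x\,\mu_i(dx)=0$ and $c_{i-1}\le c_i$ for all $1\le i\le n$; (ii) for all $2\le i\le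 n$ and all $0<y<r_{\mu_i}$ the (extended) mapping $[l_{\mu_i},y]\to\mathbb{R}\cup\{+\infty\}$, $\zeta\mapsto\frac{c^i(\zeta,y)}{y-\zeta}$, has a unique minimizer $\zeta^\star$, and $c_i(y)>c_{\imath_i(y;y)}(y)$ whenever $\zeta^\star<y$.
   Formalization: The third and fifth implications (the first and last of those for ȷ_n(y)≠0) are stated for y>0 instead of y≥0: at y=0 they can fail for n=3 under Assumption A, when c_1(0)=c_2(0) and c_2 has a kink at 0, so that ξ_2 is not right-continuous at 0. *)

(* Defs.v *)
From HB Require Import structures.
From mathcomp Require Import all_boot all_order all_algebra.
From mathcomp Require Import all_classical all_reals all_analysis.

Set Implicit Arguments.
Unset Strict Implicit.
Unset Printing Implicit Defensive.

Import Order.TTheory GRing.Theory Num.Theory.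
Import numFieldNormedType.Exports.

Local Open Scope classical_set_scope.
Local Open Scope ring_scope.

(** * Continuous-time processes *)

(* Time is [R], but only the values at times t >= 0 matter: every condition
   below is restricted to [0, +oo[. *)

Definition filtration (d : measure_display) (T : measurableType d)
    (R : realType) (F : R -> set (set T)) : Prop :=
  [/\ forall t, 0 <= t -> sigma_algebra [set: T] (F t),
      forall t, 0 <= t -> F t `<=` measurable
    & forall s t, 0 <= s -> s <= t -> F s `<=` F t].

Definition usual_hypotheses (d : measure_display) (T : measurableType d)
    (R : realType) (P : probability T R) (F : R -> set (set T)) : Prop :=
  [/\ filtration F,
      forall t, 0 <= t -> F t = \bigcap_(s in `]t, +oo[) F s
    & forall A, P.-negligible A -> F 0 A].

Definition adapted (d : measure_display) (T : measurableType d)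
    (R : realType) (F : R -> set (set T)) (X : R -> T -> R) : Prop :=
  forall t, 0 <= t ->
  forall U : set (measurableTypeR R), measurable U -> F t (X t @^-1` U).

(* The last clause is E[X_t | F_s] = X_s a.s., with the conditional
   expectation spelled out (X_s being F_s-measurable and integrable). *)
Definition martingale (d : measure_display) (T : measurableType d)
    (R : realType) (P : probability T R) (F : R -> set (set T))
    (X : R -> T -> R) : Prop :=
  [/\ adapted F X,
      forall t, 0 <= t -> P.-integrable [set: T] (EFin \o X t)
    & forall s t, 0 <= s -> s <= t -> forall A, F s A ->
        \int[P]_(w in A) X t w = \int[P]_(w in A) X s w].

Definition stopping_time (d : measure_display) (T : measurableType d)
    (R : realType) (F : R -> set (set T)) (sigma : T -> \bar R) : Prop :=
  (forall w, 0 <= sigma w)%E /\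
  (forall t, 0 <= t -> F t [set w | (sigma w <= t%:E)%E]).

Definition stopped (T : Type) (R : realType) (X : R -> T -> R)
    (sigma : T -> \bar R) : R -> T -> R :=
  fun t w => X (fine (Order.min t%:E (sigma w))) w.

Definition local_martingale (d : measure_display) (T : measurableType d)
    (R : realType) (P : probability T R) (F : R -> set (set T))
    (X : R -> T -> R) : Prop :=
  adapted F X /\
  exists sigma : nat -> T -> \bar R,
    [/\ forall m, stopping_time F (sigma m),
        {ae P, forall w, nondecreasing_seq (sigma ^~ w)},
        {ae P, forall w, sigma ^~ w @ \oo --> +oo%E}
      & forall m,
          martingale P F (fun t w => stopped X (sigma m) t w - X 0 w)].

Definition continuous_process (T : Type) (R : realType) (X : R -> T -> R)
    : Prop :=
  forall w, {within [set t : R | 0 <= t], continuous (X ^~ w)}.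

(* The quadratic variation <X> of a continuous local martingale X: the process,
   unique up to indistinguishability, with these properties. *)
Definition is_quadratic_variation (d : measure_display)
    (T : measurableType d) (R : realType) (P : probability T R)
    (F : R -> set (set T)) (X Q : R -> T -> R) : Prop :=
  [/\ adapted F Q, continuous_process Q,
      forall w, Q 0 w = 0,
      forall w s t, 0 <= s -> s <= t -> Q s w <= Q t w
    & local_martingale P F (fun t w => X t w ^+ 2 - Q t w)].

Definition no_constancy (d : measure_display) (T : measurableType d)
    (R : realType) (P : probability T R) (X : R -> T -> R) : Prop :=
  {ae P, forall w, forall s t, 0 <= s -> s < t ->
    exists2 u, s <= u <= t & X u w != X s w}.

Definition running_max (T : Type) (R : realType) (X : R -> T -> R) (t : R)
    (w : T) : R :=
  sup [set X s w | s in `[0, t]].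

(** * Call prices and endpoints *)

(* The measures are mu 1, ..., mu n; mu 0 and mu i for i > n play no role. *)

Definition call (R : realType) (mu : nat -> probability (measurableTypeR R) R)
    (i : nat) (z : R) : R :=
  if i is 0%N then 0 else \int[mu i]_x Num.max (x - z) 0.

Definition left_derivative (R : realType) (f : R -> R) (y : R) : R :=
  lim ((f (y + h) - f y) / h @[h --> 0^'-]).

Definition right_endpoint (R : realType)
    (nu : probability (measurableTypeR R) R) : \bar R :=
  ereal_inf [set x%:E | x in [set x : R | nu `]x, +oo[%classic = 0%E]].

Definition left_endpoint (R : realType)
    (nu : probability (measurableTypeR R) R) : \bar R :=
  ereal_sup [set x%:E | x in [set x : R | nu `[x, +oo[%classic = 1%E]].

(** * The recursion for xi_i and K_i *)

(* Here y is fixed and [h k] is the pair (xi_k(y), K_k(y)), for k < i. *)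

(* The maximum is 0 when no k < i qualifies, which for i > 0 happens only at
   z = -oo, as xi_0 = -oo. *)
Definition last_below (R : realType) (h : nat -> \bar R * R) (i : nat)
    (z : \bar R) : nat :=
  (\max_(k < i | ((h k).1 < z)%E) k)%N.

Definition reduced_call (R : realType)
    (mu : nat -> probability (measurableTypeR R) R) (h : nat -> \bar R * R)
    (i : nat) (y z : R) : R :=
  let k := last_below h i z%:E in
  call mu i z - (call mu k z - (y - z) * (h k).2).

(* The extended objective on [l_(mu_i), y]. Its two boundary rules overlap only
   for l_(mu_i) = y (which forces y = 0 and mu_i = delta_0); the second one
   would then read 0 / 0, so the rule for z = y comes first. *)
Definition objective (R : realType)
    (mu : nat -> probability (measurableTypeR R) R) (h : nat -> \bar R * R)
    (i : nat) (y : R) (z : \bar R) : \bar R :=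
  if z == y%:E then
    let k := last_below h i y%:E in
    if call mu i y == call mu k y then
      (- left_derivative (call mu i) y + left_derivative (call mu k) y
       + (h k).2)%:E
    else +oo%E
  else if z == left_endpoint (mu i) then
    (if z is l%:E then (- l / (y - l))%:E else 1%E)
  else (reduced_call mu h i y (fine z) / (y - fine z))%:E.

Definition minimizers (R : realType)
    (mu : nat -> probability (measurableTypeR R) R) (h : nat -> \bar R * R)
    (i : nat) (y : R) : set (\bar R) :=
  [set z | (left_endpoint (mu i) <= z <= y%:E)%E /\
     forall z', (left_endpoint (mu i) <= z' <= y%:E)%E ->
       (objective mu h i y z <= objective mu h i y z')%E].

Definition xiK_step (R : realType)
    (mu : nat -> probability (measurableTypeR R) R) (h : nat -> \bar R * R)
    (i : nat) (y : R) : \bar R * R :=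
  let z := ereal_sup (minimizers mu h i y) in (z, fine (objective mu h i y z)).

(* [xiK_upto mu y i k] is (xi_k(y), K_k(y)) for k <= i. *)
Fixpoint xiK_upto (R : realType)
    (mu : nat -> probability (measurableTypeR R) R) (y : R) (i : nat)
    : nat -> \bar R * R :=
  if i is i'.+1 then
    let h := xiK_upto mu y i' in
    fun k => if k == i'.+1 then xiK_step mu h i'.+1 y else h k
  else fun=> (-oo%E, 0).

Definition xiK (R : realType) (mu : nat -> probability (measurableTypeR R) R)
    (y : R) (k : nat) : \bar R * R :=
  xiK_upto mu y k k.

Definition xi (R : realType) (mu : nat -> probability (measurableTypeR R) R)
    (i : nat) (y : R) : \bar R :=
  (xiK mu y i).1.

Definition iota_idx (R : realType)
    (mu : nat -> probability (measurableTypeR R) R) (i : nat) (z : \bar R)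
    (y : R) : nat :=
  last_below (xiK mu y) i z.

Definition jmath_idx (R : realType)
    (mu : nat -> probability (measurableTypeR R) R) (i : nat) (y : R) : nat :=
  iota_idx mu i (xi mu i y) y.

Definition strictly_increasing_at (R : realType) (f : R -> \bar R) (y : R)
    : Prop :=
  forall y' y'', 0 <= y' -> y' < y -> y < y'' -> (f y' < f y < f y'')%E.

Lemma xiK_uptoE (R : realType) (mu : nat -> probability (measurableTypeR R) R)
    (y : R) (i k : nat) : (k <= i)%N -> xiK_upto mu y i k = xiK mu y k.
Proof.
elim: i => [|i IH]; first by rewrite leqn0 => /eqP ->.
rewrite leq_eqVlt => /orP[/eqP -> //|]; rewrite ltnS => ki /=.
by rewrite ltn_eqF ?ltnS // IH.
Qed.

Lemma eq_last_below (R : realType) (h h' : nat -> \bar R * R) (i : nat)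
    (z : \bar R) : (forall k, (k < i)%N -> h k = h' k) ->
  last_below h i z = last_below h' i z.
Proof. by move=> hh; apply: eq_bigl => k; rewrite hh. Qed.

Lemma last_below_lt (R : realType) (h : nat -> \bar R * R) (i : nat)
    (z : \bar R) : (last_below h i.+1 z < i.+1)%N.
Proof. by rewrite ltnS; apply/bigmax_leqP => k _; rewrite -ltnS. Qed.

Lemma eq_objective (R : realType)
    (mu : nat -> probability (measurableTypeR R) R) (h h' : nat -> \bar R * R)
    (i : nat) (y : R) : (forall k, (k < i.+1)%N -> h k = h' k) ->
  objective mu h i.+1 y = objective mu h' i.+1 y.
Proof.
move=> hh; apply/funext => z; rewrite /objective /reduced_call.
by rewrite !(eq_last_below _ hh) !hh ?last_below_lt.
Qed.

Lemma xiK0 (R : realType) (mu : nat -> probability (measurableTypeR R) R)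
    (y : R) : xiK mu y 0 = (-oo%E, 0).
Proof. by []. Qed.

Lemma xiKS (R : realType) (mu : nat -> probability (measurableTypeR R) R)
    (y : R) (i : nat) :
  xiK mu y i.+1 = xiK_step mu (xiK mu y) i.+1 y.
Proof.
rewrite {1}/xiK /= eqxx /xiK_step /minimizers (@eq_objective _ _ _ (xiK mu y))//.
by move=> k; rewrite ltnS => /xiK_uptoE.
Qed.

Definition assumption_A (R : realType) (n : nat)
    (mu : nat -> probability (measurableTypeR R) R) : Prop :=
  (forall i, (1 <= i <= n)%N ->
    [/\ (mu i).-integrable [set: R] (fun x => x%:E),
        \int[mu i]_x x = 0
      & forall z, call mu i.-1 z <= call mu i z]) /\
  (forall i, (2 <= i <= n)%N ->
    forall y, 0 < y -> (y%:E < right_endpoint (mu i))%E ->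
    exists2 zstar, minimizers mu (xiK mu y) i y = [set zstar]
      & (zstar < y%:E)%E -> call mu (iota_idx mu i y%:E y) y < call mu i y).

(** * The embedding *)

(* Once tau_i = +oo, tau_(i+1) = +oo as well: both branches give +oo. *)
Fixpoint tau (T : Type) (R : realType)
    (mu : nat -> probability (measurableTypeR R) R) (B : R -> T -> R)
    (i : nat) (w : T) : \bar R :=
  if i is i'.+1 then
    let s := tau mu B i' w in
    if (xi mu i (running_max B (fine s) w) < (B (fine s) w)%:E)%E then
      ereal_inf [set t%:E | t in [set t : R | (s <= t%:E)%E /\
        ((B t w)%:E <= xi mu i (running_max B t w))%E]]
    else s
  else 0%E.

(* Under the hypotheses on B and mu, tau_i is finite almost surely, so the value
   of [fine] at +oo is used on a null set only. *)
Definition M (T : Type) (R : realType)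
    (mu : nat -> probability (measurableTypeR R) R) (B : R -> T -> R)
    (i : nat) (w : T) : R :=
  B (fine (tau mu B i w)) w.

Definition Mbar (T : Type) (R : realType)
    (mu : nat -> probability (measurableTypeR R) R) (B : R -> T -> R)
    (i : nat) (w : T) : R :=
  running_max B (fine (tau mu B i w)) w.

(* Main.v *)
(* Almost surely [B] is unbounded above and below and positive at arbitrarily
   small times, so every [tau_i] is finite and [\bar B_t > 0] for [t > 0]. Given
   this, all the implications hold path by path as soon as [xi_1, ..., xi_n] are
   nondecreasing on ]0, +oo[: while the path runs between [tau_(k-1)] and [tau_k]
   with running maximum at least [y] it stays above [xi_k(y)], and for
   [j_n(y) < k <= n] one has [xi_k(y) >= xi_n(y)].

   For the monotonicity, write [G_k^y] for the numerator of the objective of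
   [xi_k(y)]. It equals [c_k - c_(k-1) + A_(k-1)^y], where [A_k^y(z)] is
   [(y - z) K_k(y)] for [z > xi_k(y)] and [G_k^y(z)] otherwise. For [y < y'], the
   tangency [G_k^y >= (y - .) K_k(y)], with equality at [xi_k(y)], bounds
   [G_k^(y')(z) / (y' - z)] below for [z < xi_k(y)] by a nonincreasing function
   that is exact at [xi_k(y)]; hence [xi_k(y) <= xi_k(y')]. That the bound is
   nonincreasing is proved by induction on [k]; this needs every point
   between [xi_k(y)] and [xi_k(y')] to be some [xi_k(t)], which holds because
   unique minimizers depend continuously on [y], or else convexity of [c_k]. *)

Require Import Defs.
From HB Require Import structures.
From mathcomp Require Import all_boot all_order all_algebra.
From mathcomp Require Import all_classical all_reals all_analysis.
From mathcomp Require Import measurable_realfun.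
From mathcomp Require Import ring lra.

Set Implicit Arguments.
Unset Strict Implicit.
Unset Printing Implicit Defensive.

Import Order.TTheory GRing.Theory Num.Theory.
Import numFieldNormedType.Exports.

Local Open Scope classical_set_scope.
Local Open Scope ring_scope.

(** * Tangents and their contact points *)

(** Tangency is kept in the product form [(y - z) * K <= G], which stays meaningful at [z = y],
    where the ratio is only a limit. The obstacle is that uniqueness is assumed only from index two
    on and below the right endpoint. In the remaining cases, the first index and a vanishing call,
    the gap is a single convex call. Otherwise, continuity of the contact points is a closed-graph
    argument: limits of minimizers are minimizers, provided that the gaps are jointly continuous.
    This is why the induction carries a second statement, that [A^y] grows at rate at most one in
    [y]; its upper half rests on slopes at most one, which come from the objective being at most one
    at the left endpoint. For the paths, stopping at exit times yields one ruin estimate: [- a] is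
    passed before [b] with probability at most [b / a]. Letting [a] grow turns unboundedness of
    [|B|], obtained from [B ^+ 2 - Q], into unboundedness on both sides; letting [b] vanish gives
    positivity at small times. The value [y = 0], where nothing is assumed to be unique, is computed
    by hand. *)

Section Tangents.
Context {R : realType}.
Implicit Types (c x K : nat -> R -> R) (y z : R) (k n : nat).

(* With [c], [x], [K] standing for the calls, the [xi_k] and the [K_k],
   [gap c x K k y z / (y - z)] is the objective of index [k.+1]. *)
Fixpoint hull c x K k y z : R :=
  if k is k'.+1 then
    if x k y < z then (y - z) * K k y else c k z - c k' z + hull c x K k' y z
  else 0.

Definition gap c x K k y z : R := c k.+1 z - c k z + hull c x K k y z.

(* [ts_inf] says that [K k.+1 y] is the infimum of the objective; it adds to
   [ts_touch] only when [x k.+1 y = y], where [ts_touch] reads [0 = 0]. *)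
Record tangent_system n c x K : Prop := TangentSystem {
  ts_c0 : forall z, c 0%N z = 0;
  ts_K0 : forall y, K 0%N y = 0;
  ts_le : forall k z, (k < n)%N -> c k z <= c k.+1 z;
  ts_noninc : forall k z z', (k <= n)%N -> z <= z' -> c k z' <= c k z;
  ts_lip : forall k z z', (k <= n)%N -> z <= z' -> c k z <= c k z' + (z' - z);
  ts_convex : forall k z1 z2 z3, (k <= n)%N -> z1 <= z2 -> z2 <= z3 ->
    (z3 - z1) * c k z2 <= (z3 - z2) * c k z1 + (z2 - z1) * c k z3;
  ts_xle : forall k y, (k < n)%N -> 0 < y -> x k.+1 y <= y;
  ts_touch : forall k y, (k < n)%N -> 0 < y ->
    gap c x K k y (x k.+1 y) = (y - x k.+1 y) * K k.+1 y;
  ts_above : forall k y z, (k < n)%N -> 0 < y -> z <= y ->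
    (y - z) * K k.+1 y <= gap c x K k y z;
  ts_right : forall k y z, (k < n)%N -> 0 < y -> x k.+1 y < z -> z <= y ->
    (y - z) * K k.+1 y < gap c x K k y z;
  ts_uniq : forall k y z, (0 < k < n)%N -> 0 < y -> 0 < c k.+1 y -> z <= y ->
    gap c x K k y z <= (y - z) * K k.+1 y -> z = x k.+1 y;
  ts_end : forall k y, (k < n)%N -> 0 < y -> c k.+1 y = 0 -> x k.+1 y = y;
  ts_inf : forall k y e, (k < n)%N -> 0 < y -> 0 < e ->
    exists2 z, z < y & gap c x K k y z <= (y - z) * (K k.+1 y + e);
  ts_K1 : forall k y, (k < n)%N -> 0 < y -> K k.+1 y <= 1 }.

Context {n : nat} {c x K : nat -> R -> R} (S : tangent_system n c x K).
Local Notation A := (hull c x K).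
Local Notation G := (gap c x K).

Lemma hullS k y z :
  A k.+1 y z = if x k.+1 y < z then (y - z) * K k.+1 y else G k y z.
Proof. by []. Qed.

Lemma hull_left k y z : z <= x k.+1 y -> A k.+1 y z = G k y z.
Proof. by move=> zx; rewrite hullS ltNge zx. Qed.

Lemma hull_right k y z : (k < n)%N -> 0 < y -> x k.+1 y <= z ->
  A k.+1 y z = (y - z) * K k.+1 y.
Proof.
move=> kn y0; rewrite le_eqVlt => /predU1P[<-|xz]; last by rewrite hullS xz.
by rewrite hull_left// (ts_touch S).
Qed.

Lemma hull_ge k y z : (k <= n)%N -> 0 < y -> z <= y -> (y - z) * K k y <= A k y z.
Proof.
case: k => [|k] kn y0 zy; first by rewrite (ts_K0 S) mulr0.
by rewrite hullS; case: ifP => // _; apply: (ts_above S).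
Qed.

(** As [c k <= c k.+1], the gap lies above the hull and so above the old tangent; the infimum of the
    ratios can only increase with the index. *)
Lemma tangent_slope_le k y : (k < n)%N -> 0 < y -> K k y <= K k.+1 y.
Proof.
move=> kn y0; apply/ler_addgt0Pr => e e0.
have [z zy Gz] := ts_inf S kn y0 e0.
have := hull_ge (ltnW kn) y0 (ltW zy); have := ts_le S z kn.
rewrite /gap in Gz; move=> cc AK.
have : (y - z) * K k y <= (y - z) * (K k.+1 y + e) by lra.
by rewrite ler_pM2l// subr_gt0.
Qed.

Lemma tangent_slope_ge0 k y : (k <= n)%N -> 0 < y -> 0 <= K k y.
Proof.
elim: k => [|k IH] kn y0; first by rewrite (ts_K0 S).
by rewrite (le_trans (IH (ltnW kn) y0))// tangent_slope_le.
Qed.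

Lemma tangent_system_ge0 k z : (k <= n)%N -> 0 <= c k z.
Proof.
elim: k => [|k IH] kn; first by rewrite (ts_c0 S).
by rewrite (le_trans (IH (ltnW kn)))// (ts_le S).
Qed.

(** Each index adds a difference of two calls, of slopes in [-1, 1]; right of a contact the hull is
    a line whose slope is at most one in modulus. The constant is crude, but independent of [y]. *)
Lemma gap_lip k y z z' : (k < n)%N -> 0 < y -> z <= z' -> z' <= y ->
  `|G k y z - G k y z'| <= 2 * k.+1%:R * (z' - z).
Proof.
move=> + y0; elim: k z z' => [|k IH] z z' kn zz' z'y.
  rewrite /gap/= !(ts_c0 S) ler_norml.
  by have := ts_noninc S kn zz'; have := ts_lip S kn zz'; lra.
suff: `|A k.+1 y z - A k.+1 y z'| <= 2 * k.+1%:R * (z' - z).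
  rewrite /gap (natrD _ 1 k.+1) !ler_norml.
  have := ts_noninc S kn zz'; have := ts_lip S kn zz'.
  have := ts_noninc S (ltnW kn) zz'; have := ts_lip S (ltnW kn) zz'; lra.
have k1n := ltnW kn.
have right u u' : x k.+1 y <= u -> u <= u' ->
    `|A k.+1 y u - A k.+1 y u'| <= 2 * k.+1%:R * (u' - u).
  move=> xu uu'; rewrite !hull_right ?(le_trans xu)//.
  have -> : (y - u) * K k.+1 y - (y - u') * K k.+1 y = (u' - u) * K k.+1 y by ring.
  rewrite normrM ger0_norm ?subr_ge0//.
  rewrite mulrC ler_wpM2r ?subr_ge0// ger0_norm ?tangent_slope_ge0//.
  rewrite (le_trans (ts_K1 S k1n y0))//.
  by rewrite -natrM ler1n.
have left u u' : u <= u' -> u' <= x k.+1 y ->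
    `|A k.+1 y u - A k.+1 y u'| <= 2 * k.+1%:R * (u' - u).
  move=> uu' u'x; rewrite !hull_left ?(le_trans uu')//.
  by apply: IH => //; rewrite (le_trans u'x)// (ts_xle S).
have [xz|/ltW zx] := leP (x k.+1 y) z; first exact: right.
have [z'x|/ltW xz'] := leP z' (x k.+1 y); first exact: left.
rewrite (le_trans (ler_distD (A k.+1 y (x k.+1 y)) _ _))//.
by rewrite (le_trans (lerD (left _ _ zx _) (right _ _ _ xz')))//; lra.
Qed.

(** Earlier calls are smaller and vanish at [y] as well, so all earlier contacts sit at [y] and the
    hull telescopes. *)
Lemma gap_end k y z : (k < n)%N -> 0 < y -> c k.+1 y = 0 -> z <= y ->
  G k y z = c k.+1 z.
Proof.
move=> + y0; elim: k => [|k IH] kn cy zy; rewrite /gap.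
  by rewrite /= (ts_c0 S); lra.
have k1n := ltnW kn.
have cy' : c k.+1 y = 0.
  by apply/le_anti; rewrite tangent_system_ge0// andbT -cy (ts_le S).
by rewrite hull_left ?(ts_end S k1n)// IH//; lra.
Qed.

(* For [z <= x k.+1 y], tangency at [y] bounds [G k y' z / (y' - z)] below by
   [excess k y y' z + (K k.+1 y - K k y) * ((y - z) / (y' - z))], with equality
   at [z = x k.+1 y]. *)
Definition excess k y y' z : R :=
  (A k y' z - A k y z + (y - z) * K k y) / (y' - z).

Definition excess_noninc k := forall y y' z1 z2, 0 < y -> y < y' ->
  z1 <= z2 -> z2 <= y -> excess k y y' z2 <= excess k y y' z1.

(** With [gap_lip], this makes the gaps jointly continuous, which is what passing to limits of
    contact points requires. *)
Definition hull_lip k := forall y y' z, 0 < y -> y < y' -> z <= y ->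
  A k y z <= A k y' z <= A k y z + (y' - y).

Lemma ratio_noninc y y' z1 z2 : y < y' -> z1 <= z2 -> z2 <= y ->
  (y - z2) / (y' - z2) <= (y - z1) / (y' - z1).
Proof.
move=> yy' zz zy; rewrite ler_pdivrMr; last lra.
by rewrite mulrAC ler_pdivlMr; [nra|lra].
Qed.

Lemma single_crossing k y y' z : (k < n)%N -> excess_noninc k ->
  0 < y -> y < y' -> z <= x k.+1 y ->
  G k y' (x k.+1 y) / (y' - x k.+1 y) <= G k y' z / (y' - z).
Proof.
move=> kn Ek y0 yy' zx.
have xy := ts_xle S kn y0.
(* [f] is the objective at [y'] with the part [G k y] of its numerator replaced by the tangent at
   [y]. In this form it is a nonincreasing excess plus a nonnegative multiple of a nonincreasing
   ratio. *)
pose f u := excess k y y' u + (K k.+1 y - K k y) * ((y - u) / (y' - u)).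
have fE u : u <= y ->
    f u = (A k y' u - A k y u + (y - u) * K k.+1 y) / (y' - u).
  by move=> uy; rewrite /f /excess; field; lra.
have -> : G k y' (x k.+1 y) / (y' - x k.+1 y) = f (x k.+1 y).
  rewrite fE// -(ts_touch S kn y0) /gap; congr (_ / _); ring.
rewrite (@le_trans _ _ (f z))//.
  rewrite /f lerD ?Ek// ler_wpM2l ?subr_ge0 ?tangent_slope_le//.
  exact: ratio_noninc.
have zy := le_trans zx xy.
rewrite fE// ler_pM2r ?invr_gt0; last lra.
by have := ts_above S kn y0 zy; rewrite /gap; lra.
Qed.

(** If the contact at [y'] were to the left, [single_crossing] would make the old contact another
    minimizer at [y'], to the right of the largest one. *)
Lemma contact_mono k y y' : (k < n)%N -> excess_noninc k ->
  0 < y -> y < y' -> x k.+1 y <= x k.+1 y'.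
Proof.
move=> kn Ek y0 yy'; rewrite leNgt; apply/negP => lt.
have xy := ts_xle S kn y0; have y'0 := lt_trans y0 yy'.
have := single_crossing kn Ek y0 yy' (ltW lt).
have xy' : x k.+1 y < y' by lra.
rewrite (ts_touch S kn y'0) mulrAC mulfV ?mul1r; last lra.
rewrite ler_pdivrMr ?subr_gt0// mulrC.
by have := ts_right S kn y'0 lt (ltW xy'); lra.
Qed.

(** The ratio is minus the slope of the chord from the graph of a convex function to the point
    [(y, 0)]; it decreases until the chord becomes tangent, which happens at [x k.+1 y]. *)
Lemma convex_ratio_noninc k y z1 z2 : (k < n)%N -> 0 < y ->
  (forall z, z <= y -> G k y z = c k.+1 z) ->
  z1 <= z2 -> z2 <= x k.+1 y -> z2 < y ->
  G k y z2 / (y - z2) <= G k y z1 / (y - z1).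
Proof.
move=> kn y0 Gc; rewrite le_eqVlt => /predU1P[->//|zz zx zy].
have xy := ts_xle S kn y0.
have z1y : z1 <= y by lra.
have z2y : z2 <= y by lra.
rewrite !Gc//.
rewrite ler_pdivrMr ?subr_gt0// mulrAC ler_pdivlMr; last lra.
have := ts_convex S kn (ltW zz) zx.
have := ts_touch S kn y0; rewrite Gc// => ->.
have := ts_above S kn y0 z1y; rewrite Gc// => above cvx.
(* After this scaling the claim is the sum of convexity times [y - z1] and of [above] times
   [(z2 - z1) * (y - X)]. *)
rewrite -(@ler_pM2l _ (x k.+1 y - z1)); last lra.
set X := x k.+1 y in xy zx above cvx *; set k0 := K _ _ in above cvx *.
have y1 : 0 <= y - z1 by lra.
have h1 := ler_wpM2r y1 cvx.
have y2 : 0 <= (z2 - z1) * (y - X) by rewrite mulr_ge0//; lra.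
have h2 := ler_wpM2l y2 above.
nra.
Qed.

Lemma gap_jointly_lip k y y' z z' : (k < n)%N -> hull_lip k ->
  0 < y -> 0 < y' -> z <= y -> z' <= y' ->
  `|G k y z - G k y' z'| <= `|y - y'| + 2 * k.+1%:R * `|z - z'|.
Proof.
move=> kn Lk; wlog yy' : y y' z z' / y <= y'.
  move=> wl y0 y'0 zy z'y'; have [yy'|/ltW y'y] := leP y y'; first exact: wl.
  by rewrite distrC (distrC y) (distrC z); apply: wl.
move=> y0 y'0 zy z'y'.
rewrite (le_trans (ler_distD (G k y' z) _ _))// lerD//.
  move: yy'; rewrite le_eqVlt => /predU1P[->|yy']; first by rewrite !subrr normr0.
  rewrite distrC ler_norml (distrC y) gtr0_norm ?subr_gt0// /gap.
  by have := Lk _ _ _ y0 yy' zy; lra.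
have zy' := le_trans zy yy'.
have [zz'|/ltW z'z] := leP z z'.
  by rewrite (distrC z) (ger0_norm (_ : 0 <= z' - z)) ?subr_ge0//; apply: gap_lip.
by rewrite distrC (ger0_norm (_ : 0 <= z - z')) ?subr_ge0//; apply: gap_lip.
Qed.

(** Lets cross-multiplied comparisons of ratios pass to the limit without dividing by a denominator
    that may vanish. *)
Lemma mul_le_lim (a b p q C : R) : 0 <= C ->
  (forall e, 0 < e -> exists a' b' p' q',
    [/\ `|a' - a| <= C * e, `|b' - b| <= C * e, `|p' - p| <= C * e,
        `|q' - q| <= C * e & a' * p' <= b' * q']) -> a * p <= b * q.
Proof.
move=> C0 H; apply/ler_addgt0Pr => e e0.
(* [D * r] bounds the sum of the two product errors for [r <= 1]. *)
pose D := C * (`|p| + `|a| + `|b| + `|q| + 2 * C).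
have D0 : 0 <= D by rewrite mulr_ge0// !addr_ge0// mulr_ge0.
pose r := Num.min 1 (e / (D + 1)).
have r0 : 0 < r by rewrite /r lt_min ltr01 divr_gt0//; lra.
have r1 : r <= 1 by rewrite /r ge_min lexx.
have Dr : D * r <= e.
  rewrite (@le_trans _ _ (D * (e / (D + 1))))//.
    by rewrite ler_wpM2l// /r ge_min lexx orbT.
  by rewrite mulrA ler_pdivrMr; nra.
have [a' [b' [p' [q' [ha hb hp hq hab]]]]] := H _ r0.
have mulb u u' v v' : `|u' - u| <= C * r -> `|v' - v| <= C * r ->
    `|u * v - u' * v'| <= C * r * (`|v| + `|u| + C).
  move=> hu hv.
  have -> : u * v - u' * v' = - ((u' - u) * v) - u * (v' - v) - (u' - u) * (v' - v) by ring.
  have t1 : `|(u' - u) * v| <= C * r * `|v| by rewrite normrM ler_wpM2r.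
  have t2 : `|u * (v' - v)| <= `|u| * (C * r) by rewrite normrM ler_wpM2l.
  have t3 : `|(u' - u) * (v' - v)| <= C * r * C.
    rewrite normrM ler_pM// (le_trans hv)// -[leRHS]mulr1 ler_wpM2l//.
  by rewrite !ler_norml in t1 t2 t3 *; lra.
have := mulb _ _ _ _ ha hp; have := mulb _ _ _ _ hb hq.
rewrite !ler_norml; rewrite /D in Dr; lra.
Qed.

(** Minimality of [x k.+1 y'] at [y'] passes to the limit by joint continuity of the gaps; [u] is
    then a minimizer at [y], and uniqueness names it. *)
Lemma contact_closed k y u : (0 < k < n)%N -> hull_lip k ->
  0 < y -> 0 < c k.+1 y ->
  (forall e, 0 < e ->
    exists y', [/\ 0 < y', `|y' - y| < e & `|x k.+1 y' - u| < e]) ->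
  u = x k.+1 y.
Proof.
move=> kn1 Lk y0 cy0 H; have /andP[_ kn] := kn1.
have uy : u <= y.
  apply/ler_addgt0Pr => e e0; have [|y' [y'0]] := H (e / 2); first lra.
  by rewrite !ltr_norml; have := ts_xle S kn y'0; lra.
apply: (ts_uniq S) => //.
have cross z : z < y -> G k y u * (y - z) <= G k y z * (y - u).
  move=> zy; have k0 : 0 <= k.+1%:R :> R by [].
  apply: (@mul_le_lim _ _ _ _ (2 * k.+1%:R + 1)); first lra.
  move=> e e0; pose r := Num.min e (y - z).
  have r0 : 0 < r by rewrite lt_min e0; lra.
  have re : r <= e by rewrite ge_min lexx.
  have rz : r <= y - z by rewrite ge_min lexx orbT.
  have [y' [y'0 yr xr]] := H r r0.
  have xy' := ts_xle S kn y'0.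
  have zy' : z <= y' by move: yr; rewrite ltr_norml; lra.
  exists (G k y' (x k.+1 y')), (G k y' z), (y' - z), (y' - x k.+1 y'); split.
  - rewrite (le_trans (gap_jointly_lip kn Lk y'0 y0 xy' uy))//.
    suff : 2 * k.+1%:R * `|x k.+1 y' - u| <= 2 * k.+1%:R * e by lra.
    by rewrite ler_wpM2l ?mulr_ge0//; lra.
  - rewrite (le_trans (gap_jointly_lip kn Lk y'0 y0 zy' (ltW zy)))//.
    rewrite subrr normr0 mulr0 addr0.
    have : 0 <= 2 * k.+1%:R * e by rewrite !mulr_ge0// ltW.
    lra.
  - have : 0 <= 2 * k.+1%:R * e by rewrite !mulr_ge0// ltW.
    by move: yr; rewrite ltr_norml ler_norml; lra.
  - have : e <= k.+1%:R * e by rewrite ler_peMl ?ler1n// ltW.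
    by move: yr xr; rewrite !ltr_norml ler_norml; lra.
  - rewrite (ts_touch S kn y'0).
    rewrite -mulrA mulrC ler_wpM2r ?subr_ge0// mulrC.
    exact: (ts_above S).
apply/ler_addgt0Pr => e e0.
pose r := e / (y - u + 1).
have r0 : 0 < r by rewrite divr_gt0//; lra.
have [z zy Gz] := ts_inf S kn y0 r0.
have : G k y u <= (K k.+1 y + r) * (y - u).
  rewrite -(@ler_pM2r _ (y - z)) ?subr_gt0// (le_trans (cross _ zy))//.
  by rewrite mulrAC ler_wpM2r ?subr_ge0//; lra.
have : r * (y - u) <= e.
  by rewrite /r mulrAC ler_pdivrMr; nra.
lra.
Qed.

(** A monotone function with closed graph has no jumps. At the last parameter [s] where the contact
    is at most [z], the approach from the left gives [<=] and the limit from the right gives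
    [>=]. *)
Lemma contact_ivt k y y' z : (0 < k < n)%N -> hull_lip k -> excess_noninc k ->
  0 < y -> y < y' -> 0 < c k.+1 y' -> x k.+1 y <= z -> z < x k.+1 y' ->
  exists2 t, y <= t < y' & x k.+1 t = z.
Proof.
move=> kn1 Lk Ek y0 yy' cy' xz zx; have /andP[_ kn] := kn1.
have mono t t' : 0 < t -> t <= t' -> x k.+1 t <= x k.+1 t'.
  move=> t0; rewrite le_eqVlt => /predU1P[->//|]; exact: contact_mono.
pose V := [set t | y <= t <= y' /\ x k.+1 t <= z].
have Vy : V y by split => //; rewrite lexx ltW.
have supV : has_sup V by split; [exists y|exists y' => t [/andP[]]].
pose s := sup V.
have ys : y <= s by apply: sup_upper_bound.
have sy' : s <= y' by apply: ge_sup; [exists y|move=> t [/andP[]]].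
have s0 := lt_le_trans y0 ys.
have cs : 0 < c k.+1 s by rewrite (lt_le_trans cy')// (ts_noninc S).
have xsz : x k.+1 s <= z.
  (* By monotonicity [sup X] is approached by contacts whose parameters tend to [s], so that
     closedness identifies it. *)
  pose X := [set x k.+1 t | t in V].
  have supX : has_sup X.
    split; first by exists (x k.+1 y), y.
    by exists z => _ [t [_ tz] <-].
  rewrite -(@contact_closed k s (sup X))//.
    by apply: ge_sup; [case: supX|move=> _ [t [_ tz] <-]].
  move=> e e0.
  have [t1 Vt1 st1] := sup_adherent e0 supV.
  have [_ [t2 Vt2 <-] ut2] := sup_adherent e0 supX.
  pose t := Num.max t1 t2.
  have Vt : V t by rewrite /t; case: (leP t1 t2).
  have t1t : t1 <= t by rewrite le_max lexx.
  have t2t : t2 <= t by rewrite le_max lexx orbT.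
  have yt2 : y <= t2 by case: Vt2 => /andP[].
  exists t; split; first by case: Vt => /andP[]; lra.
  - have : t <= s by apply: sup_upper_bound.
    by rewrite -/s in st1; rewrite ltr_norml; lra.
  - have : x k.+1 t <= sup X by apply: sup_upper_bound => //; exists t.
    have : x k.+1 t2 <= x k.+1 t by apply: mono => //; lra.
    by rewrite ltr_norml; lra.
have {}sy' : s < y'.
  by rewrite lt_neqAle sy' andbT; apply: contraTN zx => /eqP <-; rewrite -leNgt.
exists s; first by rewrite ys.
apply/le_anti; rewrite xsz/=.
(* Here [inf X] is the right limit of the contacts at [s]. *)
pose X := [set x k.+1 t | t in [set t | s < t <= y']].
have zX t : s < t -> t <= y' -> z <= x k.+1 t.
  move=> st ty'; rewrite leNgt; apply/negP => xtz.
  have : t <= s by apply: sup_upper_bound => //; split; [lra|exact: ltW].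
  lra.
have X0 : X !=set0 by exists (x k.+1 y'), y' => //=; rewrite sy' lexx.
have infX : has_inf X.
  by split=> //; exists z => _ [t /andP[st ty'] <-]; apply: zX.
rewrite -(@contact_closed k s (inf X))//.
  by apply: lb_le_inf => // _ [t /andP[st ty'] <-]; apply: zX.
move=> e e0.
have [_ [t2 /andP[st2 t2y'] <-] ut2] := inf_adherent e0 infX.
pose t := Num.min t2 (s + e / 2).
have st : s < t by rewrite lt_min st2; lra.
have tt2 : t <= t2 by rewrite ge_min lexx.
have te : t <= s + e / 2 by rewrite ge_min lexx orbT.
exists t; split; first lra.
- by rewrite ltr_norml; lra.
- have : inf X <= x k.+1 t.
    by apply: ge_inf; [case: infX|exists t => //=; rewrite st (le_trans tt2)].
  have : x k.+1 t <= x k.+1 t2 by apply: mono => //; lra.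
  by rewrite ltr_norml; lra.
Qed.

Lemma objective_noninc k y y' z1 z2 : (k < n)%N -> hull_lip k ->
  excess_noninc k -> 0 < y -> y < y' ->
  x k.+1 y <= z1 -> z1 <= z2 -> z2 <= x k.+1 y' -> z2 < y' ->
  G k y' z2 / (y' - z2) <= G k y' z1 / (y' - z1).
Proof.
move=> kn Lk Ek y0 yy' xz1 zz; have y'0 := lt_trans y0 yy'.
rewrite le_eqVlt => /predU1P[z2E|z2x] z2y'.
  rewrite z2E in z2y' zz *.
  rewrite (ts_touch S kn y'0) mulrAC mulfV ?mul1r; last lra.
  rewrite ler_pdivlMr; last lra.
  by rewrite mulrC (ts_above S)//; lra.
have [cy'|cy'] := eqVneq (c k.+1 y') 0.
  by apply: convex_ratio_noninc => //; [move=> z zy; apply: gap_end|apply: ltW].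
case: k kn Lk Ek xz1 z2x cy' => [|k] kn Lk Ek xz1 z2x cy'.
  apply: convex_ratio_noninc => //; last exact: ltW.
  by move=> z _; rewrite /gap/= (ts_c0 S); lra.
have {}cy' : 0 < c k.+2 y' by rewrite lt_def cy' tangent_system_ge0.
have [t /andP[yt ty'] xt] :=
  contact_ivt (kn : (0 < k.+1 < n)%N) Lk Ek y0 yy' cy' (le_trans xz1 zz) z2x.
by rewrite -xt; apply: single_crossing => //; [lra|rewrite xt].
Qed.

(** The two contacts [u <= u'] cut the line in three. Left of [u] both hulls continue as gaps and
    the calls cancel, leaving the old excess plus a nonincreasing ratio; between them the excess is
    the objective at [y']; right of [u'] it is the constant [K k.+1 y']. *)
Lemma excess_step k : (k < n)%N -> hull_lip k -> excess_noninc k ->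
  excess_noninc k.+1.
Proof.
move=> kn Lk Ek y y' z1 z2 y0 yy' zz z2y.
have y'0 := lt_trans y0 yy'; have xx' := contact_mono kn Ek y0 yy'.
have xy := ts_xle S kn y0.
set E := excess k.+1 y y'; set u := x k.+1 y in xx' xy; set u' := x k.+1 y' in xx'.
have left v w : v <= w -> w <= u -> E w <= E v.
  move=> vw wu.
  have EE t : t <= u -> E t = excess k y y' t +
      (K k.+1 y - K k y) * ((y - t) / (y' - t)).
    move=> tu; rewrite /E /excess !hull_left ?(le_trans tu)// /gap.
    by field; lra.
  rewrite !EE ?(le_trans vw)// lerD ?Ek ?(le_trans wu)//.
  by rewrite ler_wpM2l ?subr_ge0 ?tangent_slope_le// ratio_noninc ?(le_trans wu).
have mid v w : u <= v -> v <= w -> w <= u' -> w <= y -> E w <= E v.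
  move=> uv vw wu' wy.
  have EE t : u <= t -> t <= u' -> t <= y -> E t = G k y' t / (y' - t).
    move=> ut tu' ty; rewrite /E /excess hull_left// (hull_right kn y0 ut).
    congr (_ / _); ring.
  rewrite !EE ?(le_trans uv)// ?(le_trans vw)//.
  by apply: (@objective_noninc _ y) => //; lra.
have right v w : u' <= v -> v <= w -> w <= y -> E w <= E v.
  move=> uv vw wy.
  have EE t : u' <= t -> t <= y -> E t = K k.+1 y'.
    move=> ut ty; rewrite /E /excess !hull_right ?(le_trans xx')//.
    by field; lra.
  by rewrite !EE ?(le_trans uv)// (le_trans vw).
have right' v w : u <= v -> v <= w -> w <= y -> E w <= E v.
  move=> uv vw wy.
  have [u'v|/ltW vu'] := leP u' v; first exact: right.
  have [wu'|/ltW u'w] := leP w u'; first exact: mid.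
  by apply: (@le_trans _ _ (E u')); [apply: right|apply: mid; lra].
have [uz1|/ltW z1u] := leP u z1; first exact: right'.
have [z2u|/ltW uz2] := leP z2 u; first exact: left.
by apply: (@le_trans _ _ (E u)); [apply: right'|apply: left].
Qed.

Lemma hull_lip_step k : (k < n)%N -> hull_lip k -> excess_noninc k ->
  hull_lip k.+1.
Proof.
move=> kn Lk Ek y y' z y0 yy' zy.
have y'0 := lt_trans y0 yy'; have xx' := contact_mono kn Ek y0 yy'.
have xy := ts_xle S kn y0; have xy' := ts_xle S kn y'0.
have touch := ts_touch S kn y0.
have K1 := ts_K1 S kn y0.
set u := x k.+1 y in xx' xy touch; set u' := x k.+1 y' in xx' xy'.
have GL t : t <= y -> G k y t <= G k y' t <= G k y t + (y' - y).
  by move=> ty; have := Lk _ _ _ y0 yy' ty; rewrite /gap; lra.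
have [zu|/ltW uz] := leP z u.
  by rewrite !hull_left ?GL// (le_trans zu).
rewrite (hull_right kn y0 uz).
(* From [u] on, the objective at [y'] is at most its value at [u], which [hull_lip k] bounds; slope
   at most one keeps the resulting line within [y' - y] of the old tangent. *)
have upper : G k y' u / (y' - u) * (y' - z) <= (y - z) * K k.+1 y + (y' - y).
  have /andP[_ Gu] := GL _ xy; rewrite touch in Gu.
  rewrite mulrAC ler_pdivrMr; last lra.
  apply: (@le_trans _ _ (((y - u) * K k.+1 y + (y' - y)) * (y' - z))).
    by rewrite ler_wpM2r//; lra.
  suff : 0 <= (z - u) * (y' - y) * (1 - K k.+1 y) by lra.
  by rewrite !mulr_ge0//; lra.
have [zu'|/ltW u'z] := leP z u'.
  rewrite hull_left//; apply/andP; split.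
    by have := GL _ zy; have := ts_above S kn y0 zy; lra.
  apply: le_trans upper; rewrite -ler_pdivrMr; last lra.
  by apply: (@objective_noninc _ y) => //; lra.
rewrite (hull_right kn y'0 u'z); apply/andP; split; last first.
  apply: le_trans upper; rewrite mulrC ler_wpM2r//; first lra.
  rewrite ler_pdivlMr; last lra.
  by rewrite mulrC (ts_above S)//; lra.
have u'y := le_trans u'z zy.
(* Both tangents are affine in the point. The comparison holds at [u'], and at [y], where the old
   tangent vanishes; hence it holds in between. *)
have below : (y - u') * K k.+1 y <= (y' - u') * K k.+1 y'.
  have := GL _ u'y; rewrite (ts_touch S kn y'0) -/u'.
  by have := ts_above S kn y0 u'y; lra.
have K'0 := tangent_slope_ge0 kn y'0.
move: u'y; rewrite le_eqVlt => /predU1P[u'E|u'y].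
  have -> : y - z = 0 by lra.
  by rewrite mul0r mulr_ge0//; lra.
rewrite -(@ler_pM2l _ (y - u')) ?subr_gt0//.
have := @ler_wpM2l _ (y - z) _ _ _ below; rewrite subr_ge0 => /(_ zy) h.
have : 0 <= (z - u') * (y' - y) * K k.+1 y'.
  by rewrite !mulr_ge0//; lra.
lra.
Qed.

(** The two statements need each other: the Lipschitz bound gives the continuity of the contacts
    behind [excess_step], and the monotone excess gives the ordering of contacts used in
    [hull_lip_step]. *)
Lemma hull_lip_excess k : (k <= n)%N -> hull_lip k /\ excess_noninc k.
Proof.
elim: k => [|k IH] kn.
  split=> [y y' z _ yy' _|y y' z1 z2 _ _ _ _] /=; first by rewrite lexx add0r; lra.
  by rewrite /excess /= (ts_K0 S) !subrr !mulr0 addr0 !mul0r.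
have [Lk Ek] := IH (ltnW kn).
by split; [apply: hull_lip_step|apply: excess_step].
Qed.

Theorem contact_nondecreasing k y y' : (k < n)%N -> 0 < y -> y <= y' ->
  x k.+1 y <= x k.+1 y'.
Proof.
move=> kn y0; rewrite le_eqVlt => /predU1P[->//|].
by apply: contact_mono => //; have [] := hull_lip_excess (ltnW kn).
Qed.

End Tangents.

(** * Stop-loss transforms *)

Lemma Rintegral_eq0_null d (T : measurableType d) (R : realType)
    (mu : {measure set T -> \bar R}) (f : T -> R) :
  mu.-integrable setT (EFin \o f) -> (forall x, 0 <= f x) ->
  \int[mu]_x f x = 0 -> mu [set x | f x != 0] = 0%E.
Proof.
move=> fi f0 int0.
have mf := measurable_int mu fi.
have mf' : measurable_fun setT f by exact/measurable_EFinP.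
have := ae_eq_integral_abs mu measurableT mf.
have -> : (\int[mu]_x `|(EFin \o f) x|)%E = 0%E.
  rewrite (@eq_integral _ _ _ _ _ (EFin \o f)); last first.
    by move=> x _ /=; rewrite ger0_norm.
  have := integrable_fin_num measurableT fi.
  by move: int0; rewrite /Rintegral => + /fineK <-; rewrite /= => ->.
move=> [/(_ erefl) [N [mN N0 sub]] _].
apply: (@subset_measure0 _ _ _ mu _ N) => //; last first.
  move=> x /= fx0; apply: sub => /= /(_ I) /= [fx].
  by rewrite fx eqxx in fx0.
rewrite (_ : [set _ | _] = f @^-1` (~` [set 0])).
  by rewrite -[X in measurable X]setTI; apply: mf' => //; apply: measurableC.
by apply/seteqP; split=> x /= /eqP.
Qed.

Section StopLoss.
Context {R : realType} (nu : probability (measurableTypeR R) R).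
Hypothesis nui : nu.-integrable [set: R] (fun x => x%:E).
Hypothesis nu0 : \int[nu]_x x = 0.

Definition stop_loss (z : R) : R := \int[nu]_x Num.max (x - z) 0.

Lemma integrable_stop_loss z :
  nu.-integrable [set: R] (EFin \o (fun x => Num.max (x - z) 0)).
Proof.
apply: (@le_integrable _ (measurableTypeR R) _ nu setT measurableT _
  (fun x : R => (x - z)%:E)) => //.
- apply/measurable_EFinP; apply: measurable_maxr => //.
  exact: measurable_funB.
- move=> x _ /=; rewrite lee_fin ger0_norm ?le_max ?lexx ?orbT//.
  by rewrite ge_max ler_norm normr_ge0.
- apply: (@integrableB _ (measurableTypeR R) _ nu setT measurableT
    (fun x : R => x%:E) (fun=> z%:E)) => //.
  exact: finite_measure_integrable_cst.
Qed.

Lemma integrable_put z :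
  nu.-integrable [set: R] (EFin \o (fun x => Num.max (z - x) 0)).
Proof.
have := @integrableB _ (measurableTypeR R) _ nu setT measurableT _ _
  (integrable_stop_loss z)
  (@integrableB _ (measurableTypeR R) _ nu setT measurableT
    (fun x : R => x%:E) (fun=> z%:E) nui
    (finite_measure_integrable_cst nu z measurableT)).
apply: eq_integrable => // x _ /=; rewrite -EFinB; congr (_%:E).
by case: (leP (x - z) 0) => [|]; case: (leP (z - x) 0) => [|]; lra.
Qed.

(** Put-call parity for mean zero. It reduces the lower bound [- z], the Lipschitz bound and the
    behaviour at minus infinity to facts about the put. *)
Lemma stop_loss_put z : stop_loss z + z = \int[nu]_x Num.max (z - x) 0.
Proof.
have <- : \int[nu]_x (Num.max (x - z) 0 - (x - z)) = \int[nu]_x Num.max (z - x) 0.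
  apply: eq_Rintegral => x _.
  by case: (leP (x - z) 0) => [|]; case: (leP (z - x) 0) => [|]; lra.
have iz := finite_measure_integrable_cst nu z measurableT.
rewrite RintegralB//; first last.
- exact: (@integrableB _ (measurableTypeR R) _ nu setT measurableT
    (fun x : R => x%:E) (fun=> z%:E)).
- exact: integrable_stop_loss.
rewrite RintegralB// nu0 Rintegral_cst//.
have -> : fine (nu [set: R]) = 1 by rewrite probability_setT.
by rewrite /stop_loss; lra.
Qed.

Lemma stop_loss_ge0 z : 0 <= stop_loss z.
Proof. by apply: Rintegral_ge0 => x _; rewrite le_max lexx orbT. Qed.

Lemma stop_loss_geN z : - z <= stop_loss z.
Proof.
have : 0 <= stop_loss z + z.
  by rewrite stop_loss_put Rintegral_ge0// => x _; rewrite le_max lexx orbT.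
lra.
Qed.

Lemma stop_loss_noninc z z' : z <= z' -> stop_loss z' <= stop_loss z.
Proof.
move=> zz'; apply: le_Rintegral => //; try exact: integrable_stop_loss.
by move=> x _; case: (leP (x - z) 0) => h; case: (leP (x - z') 0) => h'; lra.
Qed.

Lemma stop_loss_lip z z' : z <= z' -> stop_loss z <= stop_loss z' + (z' - z).
Proof.
move=> zz'; suff : stop_loss z + z <= stop_loss z' + z' by lra.
rewrite !stop_loss_put; apply: le_Rintegral => //; try exact: integrable_put.
by move=> x _; case: (leP (z - x) 0) => h; case: (leP (z' - x) 0) => h'; lra.
Qed.

Lemma stop_loss_convex z1 z2 z3 : z1 <= z2 -> z2 <= z3 ->
  (z3 - z1) * stop_loss z2 <= (z3 - z2) * stop_loss z1 + (z2 - z1) * stop_loss z3.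
Proof.
move=> z12 z23.
have i z := integrable_stop_loss z.
have iZ r z : nu.-integrable [set: R] (EFin \o (fun x => r * Num.max (x - z) 0)).
  exact: integrableZl (i z).
rewrite /stop_loss -!RintegralZl// -RintegralD//.
apply: le_Rintegral => //.
  exact: (integrableD _ (iZ _ _) (iZ _ _)).
move=> x _.
case: (leP (x - z1) 0) => h1; case: (leP (x - z2) 0) => h2;
  case: (leP (x - z3) 0) => h3; nra.
Qed.

(** By parity the left side says that the put, an integral of a nonnegative function, vanishes; so
    there is no mass below [z]. *)
Lemma stop_loss_eqN z : stop_loss z = - z <-> nu `[z, +oo[%classic = 1%E.
Proof.
have -> : `[z, +oo[%classic = ~` [set x : R | Num.max (z - x) 0 != 0].
  apply/seteqP; split=> x /=; rewrite in_itv/= andbT.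
    by move=> zx; apply/negP; rewrite negbK max_r ?subr_le0.
  by move/negP; rewrite negbK => /eqP/max_idPr; rewrite subr_le0.
have mset : measurable [set x : measurableTypeR R | Num.max (z - x) 0 != 0].
  have mf : measurable_fun [set: measurableTypeR R] (fun x : R => Num.max (z - x) 0).
    by have /measurable_EFinP := measurable_int nu (integrable_put z).
  rewrite (_ : [set _ | _] = (fun x : R => Num.max (z - x) 0) @^-1` (~` [set 0])).
    by rewrite -[X in measurable X]setTI; apply: mf => //; apply: measurableC.
  by apply/seteqP; split=> x /= /eqP.
rewrite probability_setC//; split=> [cz|].
  rewrite Rintegral_eq0_null ?sube0//; first exact: integrable_put.
  - by move=> x; rewrite le_max lexx orbT.
  - by rewrite -stop_loss_put cz addNr.
move=> n1; have n0 : nu [set x | Num.max (z - x) 0 != 0] = 0%E.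
  move: n1; rewrite -(@fineK _ (nu _)) ?fin_num_measure//.
  by rewrite -EFinB => -[n1]; congr (_%:E); lra.
suff : stop_loss z + z = 0 by lra.
rewrite stop_loss_put /Rintegral (_ : (\int[nu]_x (Num.max (z - x) 0)%:E)%E = 0%E)//.
rewrite (ae_eq_integral (cst 0%E))//; first by rewrite integral0.
  exact: (measurable_int nu (integrable_put z)).
exists [set x | Num.max (z - x) 0 != 0]; split => // x /= /not_implyP[_ h].
by apply/eqP => h'; apply: h; rewrite h'.
Qed.

Lemma stop_loss_eq0 z : nu `]z, +oo[%classic = 0%E -> stop_loss z = 0.
Proof.
move=> n0; rewrite /stop_loss /Rintegral.
rewrite (ae_eq_integral (cst 0%E))//; first by rewrite integral0.
  exact: (measurable_int nu (integrable_stop_loss z)).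
exists `]z, +oo[%classic; split => //.
move=> x /= /not_implyP[_ h]; rewrite in_itv/= andbT ltNge; apply/negP => xz.
by apply: h; rewrite max_r// subr_le0.
Qed.

(** The puts at [- k] tend to zero by dominated convergence, [|x|] being a bound; the extra [m] lets
    [z] be chosen as far left as desired. *)
Lemma stop_loss_Noo e m : 0 < e -> exists2 z, z < m & stop_loss z + z < e.
Proof.
move=> e0.
have cvg : {ae nu, forall x, setT x ->
    (Num.max (- k%:R - x) 0)%:E @[k --> \oo] --> cst 0%E x}.
  apply: aeW => x _; apply: cvg_near_cst; near=> k.
  rewrite max_r//; have : - x <= k%:R.
    by near: k; exact: nbhs_infty_ger.
  lra.
have bound : {ae nu, forall x k, setT x ->
    (`|(Num.max (- k%:R - x) 0)%:E| <= `|x|%:E)%E}.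
  apply: aeW => x k _ /=; rewrite lee_fin ger0_norm ?le_max ?lexx ?orbT//.
  have k0 : 0 <= k%:R :> R by [].
  by rewrite ge_max normr_ge0 andbT; have := ler_norm (- x); rewrite normrN; lra.
have [_ _ ] := @dominated_convergence _ (measurableTypeR R) _ nu setT measurableT
  (fun k x => (Num.max (- k%:R - x) 0)%:E) (cst 0%E) (fun x => `|x|%:E)
  (fun k => measurable_int nu (integrable_put (- k%:R))) (measurable_cst _)
  cvg (integrable_norm nui) bound.
rewrite integral0 => /fine_cvgP[_] /cvgrPdist_lt/(_ e e0)[N _ H].
pose k := maxn N (Num.trunc (`|m| + 1)).+1.
exists (- k%:R).
  have : (Num.trunc (`|m| + 1)).+1%:R <= k%:R :> R by rewrite ler_nat leq_maxr.
  have := truncnS_gt (`|m| + 1); have := ler_norm (- m); rewrite normrN; lra.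
have := H k (leq_maxl _ _); rewrite /= sub0r normrN.
rewrite stop_loss_put => /(le_lt_trans _); apply; exact: ler_norm.
Unshelve. all: end_near.
Qed.

End StopLoss.

(** * The contact points of the embedding *)

Section LeftDerivative.
Context {R : realType} (f : R -> R).
Hypothesis fcvx : forall z1 z2 z3, z1 <= z2 -> z2 <= z3 ->
  (z3 - z1) * f z2 <= (z3 - z2) * f z1 + (z2 - z1) * f z3.
Hypothesis fnoninc : forall z z', z <= z' -> f z' <= f z.

Let q y h := (f (y + h) - f y) / h.

Let q_nondec y h h' : h <= h' -> h' < 0 -> q y h <= q y h'.
Proof.
have qE t : t < 0 -> q y t = (f y - f (y + t)) / - t.
  by move=> t0; rewrite /q; field; lra.
move=> hh' h'0; rewrite !qE//; last lra.
rewrite ler_pdivrMr; last lra.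
rewrite mulrAC ler_pdivlMr; last lra.
have z12 : y + h <= y + h' by lra.
have z23 : y + h' <= y by lra.
have := fcvx z12 z23; lra.
Qed.

Let q_le0 y h : h < 0 -> q y h <= 0.
Proof.
move=> h0; have : f y <= f (y + h) by apply: fnoninc; lra.
by move=> ?; rewrite /q ler_ndivrMr// mul0r subr_ge0.
Qed.

(** Convexity makes the quotients monotone and monotonicity of [f] bounds them by zero, so the [lim]
    in [left_derivative] is a true limit. *)
Let cvg_left_derivative y :
  q y h @[h --> 0^'-] --> left_derivative f y.
Proof.
apply: nondecreasing_at_left_is_cvgr; apply: nearW => x.
  move=> a b; rewrite !in_itv/= => /andP[_ a0] /andP[_ b0] ab.
  exact: q_nondec.
by exists 0 => _ [b /= + <-]; rewrite in_itv/= => /andP[_ b0]; exact: q_le0.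
Qed.

Lemma left_derivative_ge y z : z < y -> f y - f z <= left_derivative f y * (y - z).
Proof.
move=> zy; rewrite -ler_pdivrMr ?subr_gt0//.
have -> : (f y - f z) / (y - z) = q y (z - y).
  by rewrite /q (addrC y (z - y)) subrK; field; lra.
have cv := @cvg_left_derivative y.
apply: limr_ge; first by apply/cvg_ex; eexists; exact: cv.
near=> h; apply: q_nondec.
  by apply: ltW; near: h; apply: nbhs_left_gt; lra.
by near: h; exact: nbhs_left_lt.
Unshelve. all: by end_near. Qed.

Lemma left_derivative_near y e : 0 < e -> exists2 d, 0 < d &
  forall z, y - d < z -> z < y ->
    (left_derivative f y - e) * (y - z) <= f y - f z.
Proof.
move=> e0; have /cvgrPdist_lt/(_ _ e0) := @cvg_left_derivative y.
move=> [d /= d0 H]; exists d => // z dz zy.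
have := H (z - y); rewrite /= sub0r normrN ltr0_norm; last lra.
rewrite subr_lt0 /q (addrC y (z - y)) subrK => /(_ _ zy); rewrite ltr_norml => h.
have {}h : left_derivative f y - e <= (f z - f y) / (z - y) by apply: ltW; lra.
rewrite -ler_pdivlMr ?subr_gt0// (le_trans h)//.
rewrite le_eqVlt; apply/orP; left; apply/eqP; field; lra.
Qed.

End LeftDerivative.

(** * Peeling off the index of the last contact below a point *)

Lemma last_belowS (R : realType) (h : nat -> \bar R * R) i z :
  last_below h i.+2 z = if ((h i.+1).1 < z)%E then i.+1 else last_below h i.+1 z.
Proof.
rewrite /last_below [LHS]big_mkcond [X in if _ then _ else X]big_mkcond.
rewrite big_ord_recr/=; case: ifP => _; last exact: maxn0.
by apply/maxn_idPr/bigmax_leqP => k _; case: ifP => // _; rewrite ltnW.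
Qed.

Lemma last_below1 (R : realType) (h : nat -> \bar R * R) z : last_below h 1 z = 0%N.
Proof. by rewrite /last_below big_mkcond big_ord1; case: ifP. Qed.

Lemma last_below_eq0 (R : realType) (h : nat -> \bar R * R) i z :
  (forall j, (j < i)%N -> (z <= (h j.+1).1)%E) -> last_below h i.+1 z = 0%N.
Proof.
elim: i => [|i IH] H; first exact: last_below1.
by rewrite last_belowS ltNge H// IH// => j ji; rewrite H// ltnW.
Qed.

Lemma last_below_max (R : realType) (h : nat -> \bar R * R) i k z :
  (last_below h i z < k < i)%N -> (z <= (h k).1)%E.
Proof.
move=> /andP[lk ki]; rewrite leNgt; apply/negP => hz.
have := @leq_bigmax_cond _ (fun j : 'I_i => ((h j).1 < z)%E)
  (fun j => j : nat) (Ordinal ki) hz.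
by move/(leq_trans lk); rewrite /= ltnn.
Qed.

Section Embedding.
Context {R : realType} {n : nat} {mu : nat -> probability (measurableTypeR R) R}.
Hypothesis muA : assumption_A n mu.

Local Notation c := (call mu).
Local Notation l k := (left_endpoint (mu k)).

Let int k : (k < n)%N -> (mu k.+1).-integrable [set: R] (fun x => x%:E).
Proof. by move=> kn; case: muA => /(_ k.+1) [|//]. Qed.

Let mean k : (k < n)%N -> \int[mu k.+1]_x x = 0.
Proof. by move=> kn; case: muA => /(_ k.+1) [|//]. Qed.

Lemma call_le k z : (k < n)%N -> c k z <= c k.+1 z.
Proof. by move=> kn; case: muA => /(_ k.+1) [|//]. Qed.

Lemma call_mono k k' z : (k <= k')%N -> (k' <= n)%N -> c k z <= c k' z.
Proof.
elim: k' => [|k' IH]; first by rewrite leqn0 => /eqP->.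
rewrite leq_eqVlt => /predU1P[->//|]; rewrite ltnS => kk' k'n.
by rewrite (le_trans (IH kk' (ltnW k'n)))// call_le.
Qed.

Lemma call_ge0 k z : 0 <= c k z.
Proof. by case: k => [//|k]; exact: stop_loss_ge0. Qed.

Lemma call_noninc k z z' : (k <= n)%N -> z <= z' -> c k z' <= c k z.
Proof. by case: k => [//|k] kn; apply: stop_loss_noninc; exact: int. Qed.

Lemma call_lip k z z' : (k <= n)%N -> z <= z' -> c k z <= c k z' + (z' - z).
Proof.
case: k => [_ zz'|k kn]; first by rewrite add0r subr_ge0.
by apply: stop_loss_lip; [exact: int|exact: mean].
Qed.

Lemma call_convex k z1 z2 z3 : (k <= n)%N -> z1 <= z2 -> z2 <= z3 ->
  (z3 - z1) * c k z2 <= (z3 - z2) * c k z1 + (z2 - z1) * c k z3.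
Proof.
case: k => [_ _ _|k kn]; first by rewrite !mulr0 addr0.
by apply: stop_loss_convex; exact: int.
Qed.

Lemma call_geN k z : (k < n)%N -> - z <= c k.+1 z.
Proof. by move=> kn; apply: stop_loss_geN; [exact: int|exact: mean]. Qed.

Lemma call_Noo k e m : (k < n)%N -> 0 < e -> exists2 z, z < m & c k.+1 z + z < e.
Proof. by move=> kn; apply: stop_loss_Noo; [exact: int|exact: mean]. Qed.

(** The set where the call meets the line [- z] is closed, the call being continuous; its supremum,
    the left endpoint, therefore belongs to it when finite. *)
Lemma left_endpointP k z : (k < n)%N -> (z%:E <= l k.+1)%E <-> c k.+1 z = - z.
Proof.
move=> kn; have eqN := stop_loss_eqN (int kn) (mean kn).
split=> [zl|/eqN z1]; last by apply: ereal_sup_ubound; exists z.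
apply/le_anti; rewrite call_geN// andbT; apply/ler_addgt0Pr => e e0.
have : ((z - e)%:E < l k.+1)%E by rewrite (lt_le_trans _ zl)// lte_fin; lra.
move=> /ereal_sup_gt[_ [x /eqN cx <-]]; rewrite lte_fin => zex.
have {}cx : c k.+1 x = - x by exact: cx.
have [zx|xz] := leP z x.
  by have := call_lip kn zx; rewrite cx; lra.
by have := call_noninc kn (ltW xz); rewrite cx; lra.
Qed.

Lemma left_endpoint_le0 k : (k < n)%N -> (l k.+1 <= 0)%E.
Proof.
move=> kn; have H z : (z%:E <= l k.+1)%E -> z <= 0.
  by move/(left_endpointP _ kn); have := call_ge0 k.+1 z; lra.
case E : (l k.+1) H => [r| |] H.
- by rewrite lee_fin H.
- by have := H 1 (leey _); rewrite ler10.
- exact: leNye.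
Qed.

Lemma left_endpoint_real_le0 k r : (k < n)%N -> l k.+1 = r%:E -> r <= 0.
Proof.
by move=> kn E; have := left_endpoint_le0 kn; rewrite E lee_fin => /le_trans; apply.
Qed.

Lemma left_endpoint_noninc k k' : (k <= k')%N -> (k' < n)%N ->
  (l k'.+1 <= l k.+1)%E.
Proof.
move=> kk' k'n; have kn := leq_ltn_trans kk' k'n.
have H z : (z%:E <= l k'.+1)%E -> (z%:E <= l k.+1)%E.
  move=> /(left_endpointP _ k'n) cz; apply/(left_endpointP _ kn).
  apply/le_anti; rewrite call_geN// andbT -cz; exact: call_mono.
have := left_endpoint_le0 k'n.
case E : (l k'.+1) H => [r| |] // H _; last exact: leNye.
exact: H.
Qed.

(** Translates positivity of the call, the condition used for tangent systems, into the range of [y]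
    in [assumption_A]. *)
Lemma lt_right_endpoint k y : (k < n)%N -> 0 < c k.+1 y ->
  (y%:E < right_endpoint (mu k.+1))%E.
Proof.
move=> kn cy; rewrite ltNge; apply/negP => ry.
suff : c k.+1 y <= 0 by lra.
apply/ler_addgt0Pr => e e0.
have : (right_endpoint (mu k.+1) < (y + e)%:E)%E.
  by rewrite (le_lt_trans ry)// lte_fin; lra.
move=> /ereal_inf_lt[_ [x /(stop_loss_eq0 (int kn)) cx <-]]; rewrite lte_fin => xye.
have {}cx : c k.+1 x = 0 by exact: cx.
have [xy|yx] := leP x y.
  by have := call_noninc kn xy; lra.
by have := call_lip kn (ltW yx); lra.
Qed.

Definition contact k y : R := fine (xi mu k y).
Definition slope k y : R := (xiK mu y k).2.

Local Notation G := (gap c contact slope).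

(** [hull] searches the maximal index downwards: call differences telescope while the contact is not
    below [z], and the first contact below [z] contributes its tangent. *)
Lemma reduced_callE k y z : (forall j, (j < k)%N -> xi mu j.+1 y \is a fin_num) ->
  reduced_call mu (xiK mu y) k.+1 y z = G k y z.
Proof.
elim: k => [_|k IH fin].
  by rewrite /reduced_call last_below1 /gap/= mulr0 subr0 addr0.
rewrite /gap hullS -IH; last by move=> j jk; apply: fin; rewrite ltnW.
have <- : (xi mu k.+1 y < z%:E)%E = (contact k.+1 y < z).
  by rewrite -lte_fin /contact fineK// fin.
rewrite /reduced_call last_belowS /slope /xi.
by case: ifP => _; lra.
Qed.


Lemma xiSE k y : xi mu k.+1 y = ereal_sup (minimizers mu (xiK mu y) k.+1 y).
Proof. by rewrite /xi xiKS. Qed.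

Lemma slopeSE k y :
  slope k.+1 y = fine (objective mu (xiK mu y) k.+1 y (xi mu k.+1 y)).
Proof. by rewrite /slope xiSE xiKS. Qed.

(** The inequalities range over all [z <= y], although minimizers compete from [l k.+1] on: further
    left the gap is [- z] and the ratio is larger still. [cs_left] is what lets later indices know
    this form of their gap. *)
Record contact_spec k y : Prop := ContactSpec {
  cs_fin : xi mu k.+1 y = (contact k.+1 y)%:E;
  cs_left : (l k.+1 <= xi mu k.+1 y)%E;
  cs_le : contact k.+1 y <= y;
  cs_touch : G k y (contact k.+1 y) = (y - contact k.+1 y) * slope k.+1 y;
  cs_above : forall z, z <= y -> (y - z) * slope k.+1 y <= G k y z;
  cs_right : forall z, contact k.+1 y < z -> z <= y ->
    (y - z) * slope k.+1 y < G k y z;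
  cs_uniq : forall z, (0 < k)%N -> 0 < c k.+1 y -> z <= y ->
    G k y z <= (y - z) * slope k.+1 y -> z = contact k.+1 y;
  cs_end : c k.+1 y = 0 -> contact k.+1 y = y;
  cs_inf : forall e, 0 < e ->
    exists2 z, z < y & G k y z <= (y - z) * (slope k.+1 y + e);
  cs_slope1 : slope k.+1 y <= 1 }.

(** * The induction step at a fixed [y] *)

Section Step.
Context {k : nat} {y : R}.
Hypotheses (kn : (k < n)%N) (y0 : 0 < y).
Hypothesis IH : forall j, (j < k)%N -> contact_spec j y.

Local Notation obj := (objective mu (xiK mu y) k.+1 y).
Local Notation mins := (minimizers mu (xiK mu y) k.+1 y).

Let fin j : (j < k)%N -> xi mu j.+1 y \is a fin_num.
Proof. by move=> jk; rewrite (cs_fin (IH jk)). Qed.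

Lemma gap_low z : (forall j, (j < k)%N -> z <= contact j.+1 y) -> G k y z = c k.+1 z.
Proof.
elim: k => [|m IHm] H; rewrite /gap; first by rewrite /= addr0 subr0.
rewrite hull_left ?H// IHm; last by move=> j jm; rewrite H// ltnW.
by rewrite subrK.
Qed.

Lemma gap_leN z : (z%:E <= l k.+1)%E -> G k y z = - z.
Proof.
move=> zl; rewrite gap_low; first exact/left_endpointP.
move=> j jk; rewrite -lee_fin -(cs_fin (IH jk)) (le_trans zl)//.
rewrite (le_trans _ (cs_left (IH jk)))//.
by rewrite left_endpoint_noninc// ltnW.
Qed.

Lemma gap_diag : 0 <= G k y y.
Proof.
rewrite -reduced_callE//; rewrite /reduced_call subrr mul0r subr0 subr_ge0.
by rewrite call_mono// ltnW// last_below_lt.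
Qed.

(** The value prescribed at the left endpoint is the plain ratio, because the gap is [- z] there. *)
Lemma objective_lt z : z < y -> (l k.+1 <= z%:E)%E ->
  obj z%:E = (G k y z / (y - z))%:E.
Proof.
move=> zy lz; rewrite /objective eqe lt_eqF//.
case: eqP => [zl|_]; last by rewrite /= reduced_callE.
by rewrite gap_leN ?zl.
Qed.

Lemma objective_Noo : l k.+1 = -oo%E -> obj -oo%E = 1%E.
Proof. by move=> lE; rewrite /objective/= lE. Qed.

Lemma objective_diag_oo : 0 < G k y y -> obj y%:E = +oo%E.
Proof.
rewrite -reduced_callE// /reduced_call subrr mul0r subr0 subr_gt0 => h.
by rewrite /objective eqxx gt_eqF.
Qed.

Lemma last_below_near : exists2 d, 0 < d & forall z, y - d < z -> z < y ->
  last_below (xiK mu y) k.+1 z%:E = last_below (xiK mu y) k.+1 y%:E.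
Proof.
elim: k fin => [_|m IHm fin']; first by exists 1 => // z _ _; rewrite !last_below1.
have [|d d0 H] := IHm; first by move=> j jm; rewrite fin'// ltnW.
have xE : (xiK mu y m.+1).1 = (contact m.+1 y)%:E by rewrite /contact fineK// fin'.
have [xy|yx] := ltP (contact m.+1 y) y.
  exists (y - contact m.+1 y); first lra.
  by move=> z z1 z2; rewrite !last_belowS xE !lte_fin xy ifT//; lra.
exists d => // z z1 z2; rewrite !last_belowS xE !lte_fin H//.
by rewrite ifF ?ifF//; apply/negbTE; rewrite -leNgt//; lra.
Qed.

(** [L] is the left limit of the ratios, hence approached by points below [y]. It is also a lower
    bound when all earlier contacts sit at [y], since the gap is then one convex call. *)
Lemma objective_diag : G k y y = 0 -> exists L, [/\ obj y%:E = L%:E,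
  (forall e, 0 < e -> exists2 z, z < y & G k y z <= (y - z) * (L + e)) &
  (forall j, (j < k)%N -> contact j.+1 y = y) ->
    L <= 1 /\ forall z, z < y -> (y - z) * L <= G k y z].
Proof.
move=> G0; have := G0; rewrite -reduced_callE// /reduced_call subrr mul0r subr0.
set i := last_below _ _ _ => /eqP; rewrite subr_eq0 => cE.
have ik : (i < k.+1)%N := last_below_lt _ _ _.
have i_n : (i <= n)%N by rewrite (leq_trans _ kn)// ltnW.
pose L := - left_derivative (c k.+1) y + left_derivative (c i) y + slope i y.
exists L; split.
- by rewrite /objective eqxx -/i cE.
- move=> e e0.
  have [d1 d10 H1] := last_below_near.
  have [d2 d20 H2] := left_derivative_near
    (fun z1 z2 z3 => @call_convex k.+1 z1 z2 z3 kn)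
    (fun z z' => @call_noninc k.+1 z z' kn) y e0.
  pose d := Num.min d1 d2.
  have d0 : 0 < d by rewrite lt_min d10.
  have dd1 : d <= d1 by rewrite ge_min lexx.
  have dd2 : d <= d2 by rewrite ge_min lexx orbT.
  pose z := y - d / 2.
  have zy : z < y by rewrite /z; lra.
  exists z => //; rewrite -reduced_callE// /reduced_call H1//; last by rewrite /z; lra.
  rewrite -/i.
  (* Only the call with the plus sign has to be approximated; for the subtracted one the chord
     inequality already points the right way. *)
  have h2 := H2 z ltac:(rewrite /z; lra) zy.
  have h3 := left_derivative_ge
    (fun z1 z2 z3 => @call_convex i z1 z2 z3 i_n)
    (fun z z' => @call_noninc i z z' i_n) zy.
  move/eqP : cE => cE; rewrite /L -/(slope i y); lra.
- move=> xy.
  have i0 : i = 0%N.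
    rewrite /i; elim: k xy fin => [|m IHm] xy' fin'; first exact: last_below1.
    rewrite last_belowS (_ : (xiK mu y m.+1).1 = (contact m.+1 y)%:E); last first.
      by rewrite /contact fineK// fin'.
    rewrite xy'// ltxx IHm// => j jm; [by rewrite xy'// ltnW|by rewrite fin'// ltnW].
  have LE : L = - left_derivative (c k.+1) y.
    rewrite /L i0 (_ : left_derivative (c 0) y = 0); first by rewrite /slope/=; lra.
    rewrite /left_derivative (_ : (fun h => _) = cst 0).
      exact: lim_cst.
    by apply/funext => h /=; rewrite subrr mul0r.
  have cy : c k.+1 y = 0 by move/eqP : cE; rewrite i0.
  have geL z : z < y -> (y - z) * L <= c k.+1 z.
    move=> zy; have := left_derivative_ge
      (fun z1 z2 z3 => @call_convex k.+1 z1 z2 z3 kn)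
      (fun z z' => @call_noninc k.+1 z z' kn) zy.
    by rewrite cy LE; lra.
  split.
    have yy1 : y - 1 < y by lra.
    have := geL _ yy1; have := call_lip kn (ltW yy1); rewrite cy; lra.
  move=> z zy; rewrite gap_low ?geL// => j jk; rewrite xy//; exact: ltW.
Qed.


Lemma exists_admissible : exists2 z, z < y & (l k.+1 <= z%:E)%E.
Proof.
have := left_endpoint_le0 kn; case: (l k.+1) => [r| |] //.
  by rewrite lee_fin => r0; exists r => //; exact: le_lt_trans r0 y0.
by exists 0 => //; rewrite leNye.
Qed.

Lemma contact_spec_min x : mins x%:E -> ereal_sup mins = x%:E ->
  (x < y -> 0 < G k y y) ->
  ((0 < k)%N -> 0 < c k.+1 y -> mins = [set x%:E]) ->
  (c k.+1 y = 0 -> x = y) -> contact_spec k y.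
Proof.
move=> minx supx Gpos uniq xend; have y_gt0 := y0.
have [/andP[lx]] := minx; rewrite lee_fin => xy le_obj.
have xiE : xi mu k.+1 y = x%:E by rewrite xiSE.
have xE : contact k.+1 y = x by rewrite /contact xiE.
have KE : slope k.+1 y = fine (obj x%:E) by rewrite slopeSE xiE.
have [z0 z0y lz0] := exists_admissible.
(* A minimizer has a finite value, since the admissible [z0 < y] does; so the [+oo] rule excludes a
   positive gap at a minimizer [y]. *)
have Gy0 : x = y -> G k y y = 0.
  move=> xyE; apply/eqP; rewrite eq_le gap_diag andbT leNgt; apply/negP => Gy.
  have := le_obj z0%:E; rewrite lz0 lee_fin (ltW z0y) xyE objective_diag_oo//.
  by move=> /(_ isT); rewrite objective_lt// leNgt ltry.
have KfE : obj x%:E = (slope k.+1 y)%:E.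
  rewrite KE; have [xy'|] := ltP x y; first by rewrite objective_lt.
  move=> yx; have xyE : x = y by apply/le_anti; rewrite xy.
  by have [L [E _ _]] := objective_diag (Gy0 xyE); rewrite xyE E.
have obj_lel z : (l k.+1 <= z <= y%:E)%E -> ((slope k.+1 y)%:E <= obj z)%E.
  by rewrite -KfE; exact: le_obj.
(* Comparison with the left endpoint [l], where the objective is [- l / (y - l)] or 1, and so at
   most 1. *)
have K1 : slope k.+1 y <= 1.
  have := obj_lel (l k.+1); rewrite lexx/=.
  rewrite (le_trans (left_endpoint_le0 kn)) ?lee_fin ?(ltW y0)//.
  move=> /(_ isT); have := left_endpoint_le0 kn.
  case E : (l k.+1) => [r| |] // _; last first.
    by rewrite objective_Noo// lee_fin.
  have r0 := left_endpoint_real_le0 kn E; have ry : r < y by lra.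
  rewrite objective_lt ?E// gap_leN ?E// lee_fin => /le_trans; apply.
  by rewrite ler_pdivrMr ?subr_gt0//; lra.
(* Left of the endpoint the ratio is [- z / (y - z) = 1 - y / (y - z)], strictly decreasing in [z]
   because [y > 0]. *)
have aboveS z : z <= y -> (z%:E < l k.+1)%E -> (y - z) * slope k.+1 y < G k y z.
  move=> zy zl; rewrite gap_leN ?ltW//.
  have := left_endpoint_le0 kn; case E : (l k.+1) => [r| |] // _; last first.
    by rewrite E in zl.
  have r0 := left_endpoint_real_le0 kn E; have ry : r < y by lra.
  have := obj_lel r%:E; rewrite E lexx lee_fin (ltW ry) => /(_ isT).
  rewrite objective_lt ?E// gap_leN ?E// lee_fin.
  rewrite E lte_fin in zl.
  rewrite ler_pdivlMr ?subr_gt0// => h.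
  have {}h := ler_wpM2l (_ : 0 <= y - z) h.
  have {}h := h ltac:(lra).
  rewrite -(@ltr_pM2l _ (y - r)); last lra.
  nra.
have above z : z <= y -> (y - z) * slope k.+1 y <= G k y z.
  move=> zy; have [lz|zl] := leP (l k.+1) z%:E; last exact/ltW/aboveS.
  move: zy; rewrite le_eqVlt => /predU1P[->|zy]; first by rewrite subrr mul0r gap_diag.
  have := obj_lel z%:E; rewrite lz lee_fin (ltW zy) objective_lt// lee_fin.
  by move=> /(_ isT); rewrite ler_pdivlMr ?subr_gt0// mulrC.
have is_min z : z < y -> G k y z <= (y - z) * slope k.+1 y -> mins z%:E.
  move=> zy Gz; have [lz|zl] := leP (l k.+1) z%:E; last first.
    by have := aboveS _ (ltW zy) zl; lra.
  split; first by rewrite lz lee_fin ltW.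
  move=> z' /obj_lel; apply: le_trans; rewrite objective_lt// lee_fin.
  by rewrite ler_pdivrMr ?subr_gt0// mulrC.
have touch : G k y x = (y - x) * slope k.+1 y.
  apply/le_anti; rewrite above// andbT; have [xy'|yx] := ltP x y.
    move: KfE; rewrite objective_lt// => -[<-].
    by rewrite mulrC divfK// subr_eq0 gt_eqF.
  have xyE : x = y by apply/le_anti; rewrite xy.
  by rewrite xyE subrr mul0r Gy0.
split; rewrite ?xE//.
- by rewrite xiE.
- move=> z xz; rewrite le_eqVlt => /predU1P[zE|zy].
    by rewrite zE subrr mul0r Gpos// -zE.
  rewrite ltNge; apply/negP => /(is_min _ zy) /ereal_sup_ubound.
  by rewrite supx lee_fin; lra.
- move=> z k0 cy; rewrite le_eqVlt => /predU1P[->|zy] Gz; last first.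
    by have := is_min _ zy Gz; rewrite uniq// => -[].
  rewrite subrr mul0r in Gz; apply/esym/le_anti; rewrite xy leNgt; apply/negP.
  by move=> /Gpos; lra.
- move=> e e0; have [xy'|yx] := ltP x y.
    by exists x => //; rewrite touch ler_wpM2l ?subr_ge0//; lra.
  have xyE : x = y by apply/le_anti; rewrite xy.
  have [L [LE infL _]] := objective_diag (Gy0 xyE).
  by have := KfE; rewrite xyE LE => -[<-]; exact: infL.
Qed.

(** The gap is the convex call itself, supported at [y] by the line given by its left derivative;
    hence [y] is a minimizer, and trivially the largest one. *)
Lemma contact_spec_end : c k.+1 y = 0 -> contact_spec k y.
Proof.
move=> cy.
have xy j : (j < k)%N -> contact j.+1 y = y.
  move=> jk; apply: (cs_end (IH jk)); apply/le_anti; rewrite call_ge0 andbT -cy.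
  by rewrite call_mono// ltnW.
have G0 : G k y y = 0 by rewrite gap_low// => j jk; rewrite xy.
have [L [LE _ /(_ xy)[L1 geL]]] := objective_diag G0.
have miny : mins y%:E.
  split; first by rewrite lexx (le_trans (left_endpoint_le0 kn)) ?lee_fin ?ltW.
  rewrite LE; case=> [z| |]//.
  - move=> /andP[lz]; rewrite lee_fin le_eqVlt => /predU1P[->|zy]; first by rewrite LE.
    rewrite objective_lt// lee_fin ler_pdivlMr ?subr_gt0// mulrC; exact: geL.
  - by rewrite leye_eq andbF.
  - by rewrite leeNy_eq => /andP[/eqP/objective_Noo-> _]; rewrite lee_fin.
apply: (@contact_spec_min y) => //.
- apply/le_anti; rewrite ereal_sup_ubound// andbT.
  by apply: ge_ereal_sup => z [/andP[]].
- by rewrite ltxx.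
- by rewrite cy ltxx.
Qed.

Lemma contact_spec_uniq : (0 < k)%N -> 0 < c k.+1 y -> contact_spec k y.
Proof.
move=> k0 cy; have [_ /(_ k.+1)] := muA; rewrite ltnS k0 kn => /(_ isT y y0).
rewrite lt_right_endpoint// => /(_ isT)[zs minE cpos].
have minzs : mins zs by rewrite minE.
have [/andP[lz zy] le_obj] := minzs.
have fin_zs : zs \is a fin_num.
  rewrite fin_numE; apply/andP; split; apply/eqP => zE; last by rewrite zE in zy.
  have lE : l k.+1 = -oo%E by apply/eqP; rewrite -leeNy_eq -zE.
  (* A minimizer at [-oo] would have value 1. Below all earlier contacts the gap is the call, and
     [c k.+1 z + z < y] says that the ratio at [z] is less than 1. *)
  have [m [m0 Hm]] : exists m, m <= y /\ forall j, (j < k)%N -> m <= contact j.+1 y.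
    elim: k => [|j [m [my Hm]]]; first by exists y.
    exists (Num.min m (contact j.+1 y)); split; first by rewrite ge_min my.
    move=> i; rewrite ltnS leq_eqVlt => /predU1P[->|ij].
      by rewrite ge_min lexx orbT.
    by rewrite ge_min Hm.
  have [z zm cz] := call_Noo m kn y0.
  have := le_obj z%:E; rewrite lE leNye lee_fin => /(_ _)/wrap[].
    by rewrite /=; lra.
  rewrite zE objective_Noo// objective_lt ?lE ?leNye//; last lra.
  rewrite gap_low; last by move=> j jk; rewrite (le_trans (ltW zm))// Hm.
  by rewrite lee_fin ler_pdivlMr; lra.
have zsE := fineK fin_zs.
rewrite -zsE in minzs minE cpos zy *.
apply: (@contact_spec_min (fine zs)) => //.
- by rewrite minE ereal_sup1.
- move=> zsy; rewrite -reduced_callE// /reduced_call subrr mul0r subr0 subr_gt0.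
  by apply: cpos; rewrite lte_fin.
- by move=> c0; rewrite c0 ltxx in cy.
Qed.

End Step.

(** Uniqueness is not assumed for the first index, so the largest minimizer is found by compactness;
    a ratio below 1 also beats the value at [-oo]. *)
Lemma azema_yor_contact y : (0 < n)%N -> 0 < y -> 0 < c 1 y -> exists x,
  [/\ x < y, c 1 x < y - x,
      forall z, z < y -> c 1 x / (y - x) <= c 1 z / (y - z) &
      forall z, x < z -> z < y -> c 1 x / (y - x) < c 1 z / (y - z)].
Proof.
move=> n0 y0 cy; pose r z := c 1 z / (y - z).
have [z0 z0y cz0] := call_Noo y n0 y0.
have r01 : r z0 < 1 by rewrite /r ltr_pdivrMr; lra.
(* Right of [b] the ratio exceeds 1, since [c 1 z >= c 1 y > y - z]. *)
pose b := y - c 1 y.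
have rb z : b < z -> z < y -> 1 < r z.
  move=> bz zy; rewrite /r ltr_pdivlMr; last lra.
  have := call_noninc n0 (ltW zy); rewrite /b in bz; lra.
(* Left of [a] the ratio exceeds [r z0]: it is at least [1 - y / (y - z)] because [c 1 z >= - z]. *)
pose a := Num.min z0 (y - y / (1 - r z0)).
have az0 : a <= z0 by rewrite ge_min lexx.
have ra z : z < a -> r z0 < r z.
  move=> za; have zy : z < y by lra.
  have {za} : y / (1 - r z0) < y - z.
    have : a <= y - y / (1 - r z0) by rewrite ge_min lexx orbT.
    lra.
  rewrite ltr_pdivrMr; last lra.
  have -> : r z = c 1 z / (y - z) by [].
  by rewrite ltr_pdivlMr; [have := call_geN z n0; lra|lra].
have z0b : z0 <= b by rewrite leNgt; apply/negP => /rb/(_ z0y); lra.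
have ab : a <= b by lra.
have cc : continuous (c 1).
  move=> z; apply/cvgrPdist_le => e e0; near=> z'.
  have zz' : `|z - z'| <= e by near: z'; apply: cvgr_dist_le => //; exact: cvg_id.
  have [h|h] := leP z z'.
    have := call_lip n0 h; have := call_noninc n0 h; move: zz'.
    by rewrite !ler_norml; lra.
  have := call_lip n0 (ltW h); have := call_noninc n0 (ltW h); move: zz'.
  by rewrite !ler_norml; lra.
have by_ : b < y by rewrite /b; lra.
have rc : {within `[a, b], continuous r}.
  apply: continuous_in_subspaceT => z; rewrite inE/= in_itv/= => /andP[_ zb].
  apply: cvgM; first exact: cc.
  apply: cvgV; first by rewrite subr_eq0 gt_eqF//; lra.
  by apply: cvgB; [exact: cvg_cst|exact: cvg_id].
have [m mab rm] := EVT_min ab rc.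
have rmz0 : r m <= r z0 by apply: rm; rewrite in_itv/= az0.
have min_m z : z < y -> r m <= r z.
  move=> zy; have [/ra|az] := ltP z a; first lra.
  have [/rb/(_ zy)|zb] := ltP b z; first lra.
  by apply: rm; rewrite in_itv/= az.
(* The minimizers up to [b]; their supremum is again one by the bounds on the call. *)
pose V := [set z | z <= b /\ r z <= r m].
have Vm : V m by split => //; move: mab; rewrite in_itv/= => /andP[].
have supV : has_sup V by split; [exists m|exists b => z []].
pose x := sup V.
have xb : x <= b by apply: ge_sup; [exists m|move=> z []].
have mx : m <= x by apply: sup_upper_bound.
have rx : r x <= r m.
  rewrite {1}/r ler_pdivrMr; last lra.
  apply/ler_addgt0Pr => e e0.
  have rm0 : 0 <= r m by rewrite divr_ge0 ?call_ge0//; move: mab; rewrite in_itv/=; lra.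
  have e1 : 0 < e / (r m + 1) by rewrite divr_gt0//; lra.
  have [z [zb rz] xz] := sup_adherent e1 supV.
  have zx : z <= x by apply: sup_upper_bound.
  have := call_noninc n0 zx.
  move: rz; rewrite {1}/r ler_pdivrMr; last lra.
  have : r m * (x - z) <= e.
    have : (r m + 1) * (x - z) <= e.
      by rewrite mulrC -ler_pdivlMr; rewrite -/x in xz; lra.
    have : 0 <= x - z by lra.
    lra.
  lra.
exists x; split.
- lra.
- have : r x < 1 by lra.
  by rewrite /r ltr_pdivrMr; lra.
- by move=> z /min_m; rewrite -/(r x) -/(r z); lra.
- move=> z xz zy; rewrite -/(r x) -/(r z) ltNge; apply/negP => rz.
  have Vz : V z.
    split; last lra.
    rewrite leNgt; apply/negP => /rb/(_ zy); lra.
  by have : z <= x := sup_upper_bound supV Vz; lra.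
Unshelve. all: by end_near. Qed.

Lemma contact_spec0 y : (0 < n)%N -> 0 < y -> 0 < c 1 y -> contact_spec 0 y.
Proof.
move=> n0 y0 cy; have IH j : (j < 0)%N -> contact_spec j y by [].
have [x [xy cx minx strict]] := azema_yor_contact n0 y0 cy.
have G0 z : G 0 y z = c 1 z by rewrite /gap/= addr0 subr0.
(* Left of the endpoint the ratio is strictly decreasing, so no minimizer lies there. *)
have lx : (l 1 <= x%:E)%E.
  rewrite leNgt; apply/negP => xl; have := left_endpoint_le0 n0.
  case E : (l 1) xl => [r| |] //; rewrite lte_fin => xr _.
  have r0 := left_endpoint_real_le0 n0 E.
  have cr : c 1 r = - r by apply/left_endpointP => //; rewrite E.
  have cx' : c 1 x = - x by apply/left_endpointP => //; rewrite E lee_fin ltW.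
  have ry : r < y by lra.
  have := minx _ ry; rewrite cr cx' ler_pdivrMr ?subr_gt0// mulrAC ler_pdivlMr ?subr_gt0//.
  nra.
have objx : objective mu (xiK mu y) 1 y x%:E = (c 1 x / (y - x))%:E.
  by rewrite objective_lt// G0.
have minsx : minimizers mu (xiK mu y) 1 y x%:E.
  split; first by rewrite lx lee_fin ltW.
  move=> [z| |]; rewrite ?objx.
  - move=> /andP[lz]; rewrite lee_fin le_eqVlt => /predU1P[->|zy].
      by rewrite objective_diag_oo ?leey ?G0.
    by rewrite objective_lt// G0 lee_fin minx.
  - by rewrite leye_eq andbF.
  - rewrite leeNy_eq => /andP[/eqP lE _]; rewrite objective_Noo// lee_fin.
    by rewrite ler_pdivrMr ?subr_gt0//; lra.
apply: (@contact_spec_min 0 y n0 y0 IH x) => //.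
- apply/le_anti; rewrite ereal_sup_ubound// andbT; apply: ge_ereal_sup.
  move=> [z| |] [/andP[lz zy] /(_ x%:E)]; rewrite lx lee_fin (ltW xy) objx => /(_ isT).
  + move: zy; rewrite !lee_fin (le_eqVlt z y) => /predU1P[->|zy].
      by rewrite objective_diag_oo ?G0// leNgt ltry.
    rewrite objective_lt// G0 lee_fin => h; rewrite leNgt; apply/negP => xz.
    by have := strict _ xz zy; lra.
  + by rewrite leye_eq in zy.
  + by rewrite leNye.
- by rewrite G0.
- by move=> c0; rewrite c0 ltxx in cy.
Qed.

Lemma contact_specP k y : (k < n)%N -> 0 < y -> contact_spec k y.
Proof.
elim/ltn_ind: k => k IH kn y0.
have {}IH j : (j < k)%N -> contact_spec j y.
  by move=> jk; apply: IH => //; exact: ltn_trans kn.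
have [cy|cy] := eqVneq (c k.+1 y) 0; first exact: contact_spec_end.
have {}cy : 0 < c k.+1 y by rewrite lt_def cy call_ge0.
case: k kn IH cy => [|k] kn IH cy; first exact: contact_spec0.
exact: contact_spec_uniq.
Qed.

Lemma call_tangent_system : tangent_system n c contact slope.
Proof.
split=> //.
- by move=> k z kn; exact: call_le.
- by move=> k z z' kn; exact: call_noninc.
- by move=> k z z' kn; exact: call_lip.
- by move=> k z1 z2 z3 kn; exact: call_convex.
- by move=> k y kn y0; exact: (cs_le (contact_specP kn y0)).
- by move=> k y kn y0; exact: (cs_touch (contact_specP kn y0)).
- by move=> k y z kn y0; exact: (cs_above (contact_specP kn y0)).
- by move=> k y z kn y0; exact: (cs_right (contact_specP kn y0)).
- by move=> k y z /andP[k0 kn] y0 cy zy; exact: (cs_uniq (contact_specP kn y0)).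
- by move=> k y kn y0; exact: (cs_end (contact_specP kn y0)).
- by move=> k y e kn y0; exact: (cs_inf (contact_specP kn y0)).
- by move=> k y kn y0; exact: (cs_slope1 (contact_specP kn y0)).
Qed.

Lemma xi_nondecreasing k y y' : (k < n)%N -> 0 < y -> y <= y' ->
  (xi mu k.+1 y <= xi mu k.+1 y')%E.
Proof.
move=> kn y0 yy'; have y'0 := lt_le_trans y0 yy'.
rewrite (cs_fin (contact_specP kn y0)) (cs_fin (contact_specP kn y'0)) lee_fin.
exact: (contact_nondecreasing call_tangent_system).
Qed.


Lemma xi_fin k y : (k < n)%N -> 0 < y -> xi mu k.+1 y \is a fin_num.
Proof. by move=> kn y0; rewrite (cs_fin (contact_specP kn y0)). Qed.

Lemma xi_le k y : (k < n)%N -> 0 < y -> (xi mu k.+1 y <= y%:E)%E.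
Proof.
move=> kn y0; have spec := contact_specP kn y0.
by rewrite (cs_fin spec) lee_fin (cs_le spec).
Qed.

Lemma left_endpoint_xi k y : (k < n)%N -> 0 < y -> (l k.+1 <= xi mu k.+1 y)%E.
Proof. by move=> kn y0; exact: (cs_left (contact_specP kn y0)). Qed.

(** * Contact points at and near [y = 0] *)

Lemma xi_end k y : (k < n)%N -> c k.+1 0 = 0 -> 0 < y -> xi mu k.+1 y = y%:E.
Proof.
move=> kn c0 y0; have spec := contact_specP kn y0.
rewrite (cs_fin spec) (cs_end spec)//; apply/le_anti.
by rewrite call_ge0 andbT -c0 call_noninc// ltW.
Qed.

(** At [y = 0] the left endpoint has value 1, or is 0 itself. A minimizer beyond it would have index
    0, so [c k.+1 z <= - z] if it is negative and [c k.+1 0 = 0] if it is 0; either way it would not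
    lie beyond the endpoint. *)
Lemma xi0_le_left_endpoint k : (k < n)%N ->
  (forall j, (j < k)%N -> (xi mu k.+1 0 <= xi mu j.+1 0)%E) ->
  (xi mu k.+1 0 <= l k.+1)%E.
Proof.
move=> kn xile; rewrite leNgt; apply/negP => lx.
have := lx; rewrite {1}xiSE => /ereal_sup_gt[z minz lz].
have zx : (z <= xi mu k.+1 0)%E by rewrite xiSE; exact: ereal_sup_ubound.
have [/andP[_ z0] /(_ (l k.+1))] := minz.
rewrite lexx left_endpoint_le0// => /(_ isT).
have iz : last_below (xiK mu 0) k.+1 z = 0%N.
  by apply: last_below_eq0 => j jk; rewrite (le_trans zx)// xile.
have objl : objective mu (xiK mu 0) k.+1 0 (l k.+1) = 1%E.
  rewrite /objective lt_eqF ?(lt_le_trans lz)// eqxx.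
  move: lz; case E : (l k.+1) => [r| |] lz; [|by rewrite ltNge leey in lz|by []].
  rewrite sub0r divff// oppr_eq0 lt_eqF// -lte_fin -E.
  by rewrite E (lt_le_trans lz).
rewrite objl; case: z minz lz zx z0 iz => [z| |]// minz lz zx z0 iz; last first.
  by rewrite ltNge leNye in lz.
have {lz} lz : ~~ (z%:E <= l k.+1)%E by rewrite -ltNge.
rewrite /objective; case: eqP => [[zE]|/eqP]; last first.
  rewrite eqe => zn0; have {z0}zn : z < 0 by rewrite lt_neqAle zn0.
  rewrite gt_eqF ?ltNge// /reduced_call iz/= mulr0 !subr0 sub0r lee_fin.
  rewrite ler_pdivrMr ?oppr_gt0// mul1r => cz; move/negP : lz; apply.
  by apply/left_endpointP => //; apply/le_anti; rewrite cz call_geN.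
subst z; rewrite iz; case: eqP => [c0 _|_]; last by rewrite leye_eq.
by move/negP : lz; apply; apply/left_endpointP => //; rewrite oppr0.
Qed.

Lemma xi0_ge0 k : (k < n)%N -> c k.+1 0 = 0 -> (0 <= xi mu k.+1 0)%E.
Proof.
move=> kn c0; have l0 : l k.+1 = 0%E.
  apply/le_anti; rewrite left_endpoint_le0//=.
  by apply/left_endpointP => //; rewrite c0 oppr0.
rewrite xiSE; apply: ereal_sup_ubound; split; first by rewrite l0 lexx.
by move=> z'; rewrite l0 => /le_anti <-.
Qed.

Lemma xi0_ge0_inv k : (k < n)%N -> (forall j, (j < k)%N -> c j.+1 0 = 0) ->
  (0 <= xi mu k.+1 0)%E -> c k.+1 0 = 0.
Proof.
move=> kn c0 x0; rewrite -[RHS]oppr0; apply/left_endpointP => //.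
rewrite (le_trans x0)// xi0_le_left_endpoint// => j jk.
rewrite (@le_trans _ _ 0%E) ?xi0_ge0 ?c0//; last exact: ltn_trans kn.
by rewrite xiSE; apply: ge_ereal_sup => z [/andP[]].
Qed.

Lemma xi_lt0 k : (k < n)%N -> (forall j, (j < k)%N -> c j.+1 0 = 0) ->
  c k.+1 0 != 0 -> exists2 y, 0 < y & (xi mu k.+1 y < 0)%E.
Proof.
move=> kn c0 ck0; have {}ck0 : 0 < c k.+1 0 by rewrite lt_def ck0 call_ge0.
(* A contact [x >= 0] would give [c k.+1 x <= y - x <= y] by tangency and slope at most 1, whereas
   [c k.+1 x >= c k.+1 y >= c k.+1 0 - y = 2 * y]. *)
pose y := c k.+1 0 / 3; have y0 : 0 < y by rewrite /y; lra.
exists y => //; have spec := contact_specP kn y0.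
rewrite (cs_fin spec) lte_fin ltNge; apply/negP => x0.
have xy := cs_le spec; have := cs_touch spec; rewrite gap_low; last first.
  move=> j jk; have jn := ltn_trans jk kn.
  by rewrite /contact (xi_end jn (c0 _ jk) y0).
move=> touch; have := ler_wpM2l (_ : 0 <= y - contact k.+1 y) (cs_slope1 spec).
rewrite subr_ge0 => /(_ xy).
have yE : 3 * y = c k.+1 0 by rewrite /y; lra.
have := call_noninc kn xy; have := call_lip kn (ltW y0); clearbody y; lra.
Qed.

End Embedding.

(** * Optional stopping and the range of a continuous local martingale *)

Section Paths.
Context {R : realType}.
Implicit Types (f g : R -> R) (s t e : R).

Definition path_continuous f := forall s e : R, 0 <= s -> 0 < e ->
  exists2 h : R, 0 < h & forall r : R, 0 <= r -> `|r - s| < h -> `|f r - f s| < e.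

Lemma within_path_continuous f :
  {within [set t : R | 0 <= t], continuous f} -> path_continuous f.
Proof.
move=> /subspace_continuousP cf s e s0 e0.
have /cvgrPdist_lt/(_ e e0) := cf s s0.
move=> [h /= h0 H]; exists h => // r r0 rs.
by rewrite distrC; apply: H => //=; rewrite distrC.
Qed.

Lemma path_continuous_lip f g : (forall s, 0 <= s -> 0 <= g s) ->
  (forall s r, 0 <= s -> 0 <= r -> `|g r - g s| <= `|r - s|) ->
  path_continuous f -> path_continuous (f \o g).
Proof.
move=> g0 gl cf s e s0 e0; have [h h0 H] := cf (g s) e (g0 _ s0) e0.
by exists h => // r r0 rs; apply: H; [exact: g0|exact: le_lt_trans (gl _ _ s0 r0) rs].
Qed.

Lemma path_continuousP f : path_continuous f <->
  forall s, 0 <= s -> f r @[r --> within [set t : R | 0 <= t] (nbhs s)] --> f s.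
Proof.
split=> [cf s s0|cf]; last exact/within_path_continuous/subspace_continuousP.
apply/cvgrPdist_lt => e e0; have [h h0 H] := cf s e s0 e0.
by exists h => // r /= sr r0; rewrite distrC; apply: H => //; rewrite distrC.
Qed.

Lemma path_continuous_max f g : path_continuous f -> path_continuous g ->
  path_continuous (fun s => Num.max (f s) (g s)).
Proof.
move=> cf cg s e s0 e0.
have [h h0 H] := cf s e s0 e0; have [k k0 K] := cg s e s0 e0.
exists (Num.min h k); first by rewrite lt_min h0.
move=> r r0; rewrite lt_min => /andP[/(H r r0) + /(K r r0)].
rewrite !ltr_norml; case: (leP (f r) (g r)); case: (leP (f s) (g s)); lra.
Qed.

Lemma path_continuous_ge0 f (g : R) : path_continuous f -> 0 <= g ->
  (forall e, 0 < e -> exists s, [/\ g < s, s < g + e & 0 < f s]) -> 0 <= f g.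
Proof.
move=> cf g0 approx; rewrite leNgt; apply/negP => fg.
have fg0 : 0 < - f g by rewrite oppr_gt0.
have [h h0 H] := cf g _ g0 fg0; have [s [gs sg fs]] := approx h h0.
have s0 : 0 <= s by lra.
have close : `|s - g| < h by rewrite gtr0_norm ?subr_gt0//; lra.
by have := H s s0 close; rewrite ltr_norml; lra.
Qed.

(* Being the exit time from a closed set, this is the limit of the first times in
   finer and finer grids at which [0 < D] (or of [t]); the stopping argument then
   only involves stopping times with finitely many values. *)
Definition exit_time (D : R -> R) (t : R) : R :=
  inf [set s | s = t \/ (0 <= s <= t /\ 0 < D s)].

Section ExitTime.
Context (D : R -> R) (t : R).
Hypotheses (t0 : 0 < t) (cD : path_continuous D) (D0 : D 0 <= 0).
Let E := [set s | s = t \/ (0 <= s <= t /\ 0 < D s)].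

Let infE : has_inf E.
Proof. by split; [exists t; left|exists 0 => s [->|[/andP[]//]]; exact: ltW]. Qed.

Lemma exit_time_ge0 : 0 <= exit_time D t.
Proof.
by apply: lb_le_inf; [case: infE|move=> s [->|[/andP[]//]]; exact: ltW].
Qed.

Lemma exit_time_le : exit_time D t <= t.
Proof. by apply: ge_inf; [case: infE|left]. Qed.

Lemma exit_time_lb s : 0 <= s -> s <= t -> 0 < D s -> exit_time D t <= s.
Proof. by move=> s0 st Ds; apply: ge_inf; [case: infE|right; rewrite s0]. Qed.

Lemma exit_time_before s : 0 <= s -> s < exit_time D t -> D s <= 0.
Proof.
move=> s0 sG; rewrite leNgt; apply/negP => Ds.
have := exit_time_lb s0 (ltW (lt_le_trans sG exit_time_le)) Ds; lra.
Qed.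

Lemma exit_time_le0 s : 0 <= s -> s <= exit_time D t -> D s <= 0.
Proof.
move=> s0; rewrite le_eqVlt => /predU1P[sE|]; last exact: exit_time_before.
rewrite leNgt; apply/negP => Ds.
have [s00|s00] := eqVneq s 0; first by rewrite s00 in Ds; have D0' := D0; lra.
have {}s0 : 0 < s by rewrite lt_def s00.
have [h h0 H] := cD (ltW s0) Ds.
pose r := Num.max (s / 2) (s - h / 2).
have rs : r < s by rewrite /r gt_max; lra.
have r1 : s / 2 <= r by rewrite /r le_max lexx.
have r2 : s - h / 2 <= r by rewrite /r le_max lexx orbT.
have r0 : 0 <= r by lra.
have := H r r0; rewrite !ltr_norml => /(_ ltac:(lra)) Dr.
have rG : r < exit_time D t by rewrite -sE.
by have := exit_time_before r0 rG; lra.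
Qed.

Lemma exit_time_approx e : 0 < e -> exit_time D t < t ->
  exists s, [/\ 0 <= s, s < t, s < exit_time D t + e & 0 < D s].
Proof.
move=> e0 Gt; pose e' := Num.min e (t - exit_time D t).
have e'0 : 0 < e' by rewrite lt_min e0 subr_gt0.
have e'e : e' <= e by rewrite ge_min lexx.
have e't : e' <= t - exit_time D t by rewrite ge_min lexx orbT.
have [s Es sG] := inf_adherent e'0 infE.
rewrite -/(exit_time D t) in sG.
case: Es => [st|[/andP[s0 st] Ds]]; first by rewrite st in sG; lra.
exists s; split => //; lra.
Qed.

Lemma exit_timeE (g : R) : 0 <= g -> g <= t ->
  (forall r, 0 <= r -> r <= g -> D r <= 0) ->
  (forall e, 0 < e -> exists s, [/\ g < s, s < g + e & 0 < D s]) ->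
  exit_time D t = g.
Proof.
move=> g0 gt Dg approx; apply/le_anti/andP; split.
  apply/ler_addgt0Pr => e e0; have [s [gs sg Ds]] := approx e e0.
  have s0 : 0 <= s by lra.
  have [st|ts] := leP s t; first by have := exit_time_lb s0 st Ds; lra.
  by have := exit_time_le; lra.
apply: lb_le_inf; first by case: infE.
move=> s [->//|[/andP[s0 st] Ds]]; rewrite leNgt; apply/negP => sg.
by have := Dg _ s0 (ltW sg); lra.
Qed.

Definition grid (m k : nat) : R := t * k%:R / m.+1%:R.

Lemma grid_ge0 m k : 0 <= grid m k.
Proof. by rewrite /grid divr_ge0// mulr_ge0// ltW. Qed.

Lemma grid_le m j k : (j <= k)%N -> grid m j <= grid m k.
Proof. by move=> jk; rewrite /grid ler_pM2r ?invr_gt0// ler_pM2l// ler_nat. Qed.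

Lemma grid_max m : grid m m.+1 = t.
Proof. by rewrite /grid mulfK. Qed.

(** The last grid point is a hit by decree, so that a first hit always exists. *)
Definition hit m k : bool := (k == m.+1) || (0 < D (grid m k)).

Lemma hit_exists m : exists k, hit m k.
Proof. by exists m.+1; rewrite /hit eqxx. Qed.

Definition first_hit m : nat := ex_minn (hit_exists m).

Lemma first_hit_le m : (first_hit m <= m.+1)%N.
Proof. by rewrite /first_hit; case: ex_minnP => k _; apply; rewrite /hit eqxx. Qed.

Lemma first_hitP m k : first_hit m = k <->
  hit m k /\ (forall j, (j < k)%N -> ~~ hit m j).
Proof.
rewrite /first_hit; case: ex_minnP => i hi imin; split=> [<-|[hk kmin]].
  by split => // j ji; apply/negP => /imin; rewrite leqNgt ji.
apply/eqP; rewrite eqn_leq imin//= leqNgt; apply/negP => /kmin; by rewrite hi.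
Qed.

Lemma cvg_first_hit : grid m (first_hit m) @[m --> \oo] --> exit_time D t.
Proof.
apply/cvgrPdist_lt => /= e e0.
have ge m : exit_time D t <= grid m (first_hit m).
  have [] := (@first_hitP m _).1 erefl; rewrite /hit => /orP[/eqP->|Dk] _.
    by rewrite grid_max exit_time_le.
  by rewrite exit_time_lb ?grid_ge0// -(grid_max m) grid_le// first_hit_le.
suff : \forall m \near \oo, grid m (first_hit m) < exit_time D t + e.
  by apply: filterS => m h; have := ge m; rewrite ltr_norml; lra.
have [tG|Gt] := leP t (exit_time D t).
  apply: nearW => m; have : grid m (first_hit m) <= t.
    by rewrite -(grid_max m) grid_le// first_hit_le.
  by lra.
have [s [s0 st sG Ds]] := exit_time_approx e0 Gt.
have [h h0 H] := cD s0 Ds.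
pose d := Num.min h (exit_time D t + e - s).
have d0 : 0 < d by rewrite lt_min h0; lra.
have dh : d <= h by rewrite ge_min lexx.
have dG : d <= exit_time D t + e - s by rewrite ge_min lexx orbT.
have t_gt0 := t0.
near=> m.
have mesh : t / m.+1%:R < d.
  rewrite ltr_pdivrMr// mulrC -ltr_pdivrMr//.
  have : t / d <= m%:R by near: m; exact: nbhs_infty_ger.
  by rewrite -natr1; lra.
(* The first grid index strictly beyond [s]; a fine mesh keeps its point inside the neighbourhood of
   [s] where [D] is positive. *)
pose k := (Num.trunc (s * m.+1%:R / t)).+1.
have sm0 : 0 <= s * m.+1%:R / t by rewrite divr_ge0 ?mulr_ge0// ltW.
have /andP[k1 k2] := truncn_itv sm0.
have km : (k <= m.+1)%N.
  by rewrite /k truncn_lt_nat// ltr_pdivrMr// mulrC ltr_pM2l.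
have sk : s < grid m k.
  by rewrite /grid ltr_pdivlMr// -ltr_pdivrMl// mulrC.
have ks : grid m k <= s + t / m.+1%:R.
  rewrite /grid /k -[X in t * X]natr1 mulrDr mulr1 mulrDl lerD2r ler_pdivrMr//.
  by rewrite -ler_pdivlMl// [leRHS]mulrC.
clearbody d k; have hk : hit m k.
  rewrite /hit; apply/orP; right.
  have close : `|grid m k - s| < h.
    rewrite gtr0_norm ?subr_gt0// (le_lt_trans _ (lt_le_trans mesh dh))//.
    by rewrite lerBlDl.
  by have := H _ (grid_ge0 m k) close; rewrite ltr_norml; lra.
have : (first_hit m <= k)%N by rewrite /first_hit; case: ex_minnP => i _; apply.
move/(grid_le m)/le_lt_trans; apply; rewrite (le_lt_trans ks)//.
by rewrite -ltrBrDl (lt_le_trans mesh).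
Unshelve. all: by end_near. Qed.

End ExitTime.
End Paths.

Section SigmaAlgebra.
Context {T : Type} {G : set (set T)}.
Hypothesis sG : sigma_algebra setT G.

Lemma sigma_algebraI A B : G A -> G B -> G (A `&` B).
Proof. by have [_ _ _] := (sigma_algebraP (fun _ _ _ _ => I)).1 sG; apply. Qed.

Lemma sigma_algebraC A : G A -> G (~` A).
Proof. by case: sG => _ H _ /H; rewrite setTD. Qed.

Lemma sigma_algebraT : G setT.
Proof. by rewrite -setC0; apply: sigma_algebraC; case: sG. Qed.
End SigmaAlgebra.

(** * Stopping a martingale that is bounded at the exit time *)

Section OptionalStopping.
Context {d : measure_display} {T : measurableType d} {R : realType}.
Context {P : probability T R} {F : R -> set (set T)}.
Hypothesis filF : filtration F.
Context {X D : R -> T -> R}.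
Hypothesis mX : martingale P F X.
Hypothesis aD : forall s, 0 <= s -> F s [set w | 0 < D s w].
Hypothesis cX : forall w, path_continuous (X ^~ w).
Hypothesis cD : forall w, path_continuous (D ^~ w).
Context {t : R}.
Hypothesis t0 : 0 < t.

Local Notation J m w := (first_hit (D ^~ w) t m).
Local Notation G := (fun w => exit_time (D ^~ w) t).

Let sF s : 0 <= s -> sigma_algebra setT (F s).
Proof. by case: filF => + _ _; apply. Qed.

Let F_first_hit m k : (k <= m.+1)%N -> F (grid t m k) [set w | J m w = k].
Proof.
move=> km; have g0 := grid_ge0 t0 m.
have F_hit j : (j <= m.+1)%N -> F (grid t m j) [set w | hit (D ^~ w) t m j].
  move=> jm; rewrite /hit; case: eqP => _ /=.
    by rewrite (_ : mkset _ = setT); [exact: sigma_algebraT (sF (g0 j))|apply/seteqP].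
  exact: aD (g0 j).
have -> : [set w | J m w = k] = [set w | hit (D ^~ w) t m k] `&`
    [set w | forall j, (j < k)%N -> ~~ hit (D ^~ w) t m j].
  by apply/seteqP; split => w /=; move/first_hitP.
apply: sigma_algebraI; [exact: sF|exact: F_hit|].
suff H i : (i <= k)%N ->
  F (grid t m k) [set w | forall j, (j < i)%N -> ~~ hit (D ^~ w) t m j] by exact: H.
elim: i => [_|i IH ik].
  rewrite (_ : mkset _ = setT); first exact: sigma_algebraT (sF _).
  by apply/seteqP.
have -> : [set w | forall j, (j < i.+1)%N -> ~~ hit (D ^~ w) t m j] =
    [set w | forall j, (j < i)%N -> ~~ hit (D ^~ w) t m j] `&`
    ~` [set w | hit (D ^~ w) t m i].
  apply/seteqP; split=> w /= H.
    by split=> [j ji|]; [rewrite H// ltnW|apply/negP/H].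
  move=> j; rewrite ltnS leq_eqVlt => /predU1P[->|]; [exact/negP/H.2|exact: H.1].
apply: sigma_algebraI; [exact: sF|by apply: IH; exact: ltnW|].
apply: sigma_algebraC; first exact: sF.
case: filF => _ _ mono; apply: mono (F_hit i _) => //; first exact: grid_le (ltnW ik).
by rewrite (leq_trans (ltnW ik)).
Qed.

Variable lam : R.

Let A m k := [set w | J m w = k /\ `|X (grid t m k) w| <= lam].

Let F_A m k : (k <= m.+1)%N -> F (grid t m k) (A m k).
Proof.
move=> km; apply: sigma_algebraI; [exact/sF/grid_ge0|exact: F_first_hit|].
case: mX => aX _ _; have := aX _ (grid_ge0 t0 m k) _ (measurable_itv `[- lam, lam]%R).
by congr (F _ _); apply/seteqP; split=> w /=; rewrite in_itv/= ler_norml.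
Qed.

(* The [X (grid t m (J m w)) w] need not be dominated. Cut off at [lam], they
   are, and the martingale property still applies on the event where the cut-off
   is inactive. *)
Let truncated (f : nat -> T -> R) m w :=
  if `|X (grid t m (J m w)) w| <= lam then f (J m w) w else 0.

Let sum_truncated (f : nat -> T -> R) m w :
  \sum_(k < m.+2) (f k \_ (A m k)) w = truncated f m w.
Proof.
have Jm : (J m w < m.+2)%N by rewrite ltnS first_hit_le.
rewrite (bigD1 (Ordinal Jm))//= big1 ?addr0 => [|k kJ].
  rewrite /patch /truncated; case: ifPn => [/set_mem[_ ->]//|].
  by move/negP => H; case: ifP => // H2; exfalso; apply: H; apply/mem_set.
rewrite /patch ifF//; apply/negP => /set_mem[Jk _]; move/eqP: kJ; apply.
exact/val_inj.
Qed.

Let integrable_truncated (f : nat -> T -> R) m :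
  (forall k, (k < m.+2)%N -> P.-integrable setT (EFin \o f k)) ->
  P.-integrable setT (EFin \o truncated f m) /\
  \int[P]_w truncated f m w = \sum_(k < m.+2) \int[P]_(w in A m k) f k w.
Proof.
move=> fi.
have mA (k : 'I_m.+2) : measurable (A m k).
  by case: filF => _ sub _; apply: sub (F_A _); [exact: grid_ge0|rewrite -ltnS].
have fiA (k : 'I_m.+2) : P.-integrable setT (EFin \o (f k \_ (A m k))).
  rewrite -restrict_EFin; apply: (integrable_mkcond _ (mA k)).1.
  by apply: (integrableS measurableT) => //; exact: fi (ltn_ord k).
have E : (EFin \o truncated f m) =
    (fun w => \sum_(k < m.+2) ((f k \_ (A m k)) w)%:E)%E.
  by apply/funext => w /=; rewrite -sum_truncated sumEFin.
split; first by rewrite E; apply: integrable_sum => // k _; exact: fiA.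
rewrite /Rintegral (_ : (fun w => (truncated f m w)%:E) = EFin \o truncated f m)// E.
rewrite integral_sum//= -[LHS]/(fine _).
rewrite (eq_bigr (fun k : 'I_m.+2 => (\int[P]_(w in A m k) f k w)%:E)); last first.
  move=> k _; rewrite -[LHS]fineK; last exact: integrable_fin_num (fiA k).
  by congr (_%:E); rewrite Rintegral_mkcond.
by rewrite sumEFin.
Qed.

Let integral_truncated m :
  \int[P]_w truncated (fun k => X (grid t m k)) m w =
  \int[P]_w truncated (fun=> X t) m w.
Proof.
case: mX => aX iX eX.
rewrite (integrable_truncated (fun k _ => iX _ (grid_ge0 t0 m k))).2.
rewrite (integrable_truncated (fun k _ => iX _ (ltW t0))).2.
apply: eq_bigr => k _; apply/esym/eX; first exact: grid_ge0.
  by rewrite -[leRHS](grid_max t m) grid_le// -ltnS.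
by apply: F_A; rewrite -ltnS.
Qed.

Hypothesis Xlam : forall w, `|X (G w) w| < lam.

Let near_X w (e : R) : 0 < e ->
  \forall m \near \oo, `|X (grid t m (J m w)) w - X (G w) w| < e.
Proof.
move=> e0; have G0 : 0 <= G w by exact: exit_time_ge0.
have [h h0 H] := cX w G0 e0.
have /cvgrPdist_lt/(_ h h0) := cvg_first_hit t0 (cD w).
by apply: filterS => m; rewrite distrC => /(H _ (grid_ge0 t0 m _)).
Qed.

Let near_lam w : \forall m \near \oo, `|X (grid t m (J m w)) w| <= lam.
Proof.
have e0 : 0 < lam - `|X (G w) w| by rewrite subr_gt0.
have := near_X w e0; apply: filterS => m h1.
have := ler_normD (X (grid t m (J m w)) w - X (G w) w) (X (G w) w).
by rewrite subrK => h2; rewrite ltW// (le_lt_trans h2)// -ltrBrDr.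
Qed.

Let cvg_stopped w :
  truncated (fun k => X (grid t m k)) m w @[m --> \oo] --> X (G w) w.
Proof.
apply/cvgrPdist_lt => e e0; near=> m.
have h1 : `|X (grid t m (J m w)) w| <= lam by near: m; exact: near_lam.
rewrite /truncated h1 distrC; near: m; exact: near_X.
Unshelve. all: by end_near. Qed.

Let cvg_terminal w : truncated (fun=> X t) m w @[m --> \oo] --> X t w.
Proof.
apply: cvg_near_cst; have := near_lam w; apply: filterS => m h.
by rewrite /truncated h.
Qed.

Let integrable_stopped m k : P.-integrable setT (EFin \o X (grid t m k)).
Proof. by case: mX => _ iX _; exact: iX (grid_ge0 t0 m k). Qed.

(** Both cut-off integrals agree for each grid. In the limit one is dominated by [lam] and the other
    by [|X t|], and the strict bound [Xlam] makes the cut-off eventually inactive. *)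
Lemma optional_stopping :
  measurable_fun setT (fun w => X (G w) w) /\
  \int[P]_w X (G w) w = \int[P]_w X 0 w.
Proof.
have [aX iX eX] := mX.
have Xt := iX _ (ltW t0).
pose U m := truncated (fun k => X (grid t m k)) m.
pose V m := truncated (fun=> X t) m.
have Ui m : P.-integrable setT (EFin \o U m).
  exact: (integrable_truncated (fun k _ => integrable_stopped m k)).1.
have Vi m : P.-integrable setT (EFin \o V m).
  exact: (integrable_truncated (fun k _ => Xt)).1.
have lam0 (w : T) : 0 <= lam by rewrite (le_trans _ (ltW (Xlam w))).
have mU m : measurable_fun setT (EFin \o U m) := measurable_int P (Ui m).
have mV m : measurable_fun setT (EFin \o V m) := measurable_int P (Vi m).
have mXG : measurable_fun setT (fun w => X (G w) w).
  apply: (@measurable_fun_cvg _ _ _ _ U) => [m|w _]; last exact: cvg_stopped.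
  by have /measurable_EFinP := mU m.
split => //.
have UV m : (\int[P]_w (U m w)%:E = \int[P]_w (V m w)%:E)%E.
  rewrite -(fineK (integrable_fin_num measurableT (Ui m))).
  rewrite -(fineK (integrable_fin_num measurableT (Vi m))).
  by congr (_%:E); exact: integral_truncated.
have cU : {ae P, forall w, setT w ->
    (EFin \o U m) w @[m --> \oo] --> (X (G w) w)%:E}.
  by apply: aeW => w _; apply: cvg_EFin; [exact: nearW|exact: cvg_stopped].
have cV : {ae P, forall w, setT w ->
    (EFin \o V m) w @[m --> \oo] --> (X t w)%:E}.
  by apply: aeW => w _; apply: cvg_EFin; [exact: nearW|exact: cvg_terminal].
have mE : measurable_fun setT (EFin \o (fun w => X (G w) w)) by exact/measurable_EFinP.
have bU : {ae P, forall w m, setT w ->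
    (`|(EFin \o U m) w| <= (EFin \o cst lam) w)%E}.
  apply: aeW => w m _ /=; rewrite lee_fin /U /truncated.
  by case: ifP => // _; rewrite normr0 (lam0 w).
have bV : {ae P, forall w m, setT w ->
    (`|(EFin \o V m) w| <= (abse \o (EFin \o X t)) w)%E}.
  apply: aeW => w m _ /=; rewrite lee_fin /V /truncated.
  by case: ifP => // _; rewrite normr0.
have [_ _ limU] := dominated_convergence measurableT mU mE cU
  (finite_measure_integrable_cst P lam measurableT) bU.
have [_ _ limV] := dominated_convergence measurableT mV (measurable_int P Xt) cV
  (integrable_abse Xt) bV.
have intE : (\int[P]_w (X (G w) w)%:E = \int[P]_w (X t w)%:E)%E.
  apply: cvg_unique limU _ => //.
  rewrite (_ : [sequence _]_m = [sequence (\int[P]_w (V m w)%:E)%E]_m)//.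
  by apply/funext => m; exact: UV.
rewrite /Rintegral intE; apply: eX (lexx 0) (ltW t0) _ _.
exact: sigma_algebraT (sF (lexx 0)).
Qed.

End OptionalStopping.

(** The exit time without a horizon; [exit_timeE] identifies it with [exit_time D t] once [t] is
    large enough. *)
Definition exits_at (R : realType) (D : R -> R) (g : R) : Prop :=
  [/\ 0 <= g, forall r, 0 <= r -> r <= g -> D r <= 0
    & forall e, 0 < e -> exists s, [/\ g < s, s < g + e & 0 < D s]].

Lemma exits_exists (R : realType) (D : R -> R) (s : R) : path_continuous D ->
  D 0 <= 0 -> 0 <= s -> 0 < D s -> exists2 g, exits_at D g & g < s.
Proof.
move=> cD D0 s0 Ds; pose t := s + 1; have t0 : 0 < t by rewrite /t; lra.
have st : s <= t by rewrite /t; lra.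
exists (exit_time D t).
  split; [exact: exit_time_ge0|by move=> r r0; exact: exit_time_le0|move=> e e0].
  have Gt : exit_time D t < t.
    by rewrite (le_lt_trans (exit_time_lb t0 s0 st Ds))// /t; lra.
  have [r [r0 rt rG Dr]] := exit_time_approx t0 e0 Gt.
  exists r; split => //; rewrite ltNge; apply/negP => rG'.
  by have := exit_time_le0 t0 cD D0 r0 rG'; lra.
rewrite lt_neqAle exit_time_lb// andbT; apply/eqP => sE.
have := exit_time_le0 t0 cD D0 s0; rewrite sE lexx => /(_ isT); lra.
Qed.

Section ExitBound.
Context {d : measure_display} {T : measurableType d} {R : realType}.
Context {P : probability T R} {F : R -> set (set T)}.
Hypothesis filF : filtration F.

Lemma path_continuous_stopped (X : R -> T -> R) (sigma : T -> \bar R) w :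
  (0 <= sigma w)%E -> path_continuous (X ^~ w) ->
  path_continuous ((stopped X sigma) ^~ w).
Proof.
move=> s0 cX.
apply: (@path_continuous_lip _ (X ^~ w) (fun s => fine (Order.min s%:E (sigma w)))).
- move=> s sge0; case: (sigma w) s0 => [r| |] //=; last by rewrite min_l ?leey.
  by rewrite lee_fin -EFin_min/= => r0; rewrite le_min sge0.
- move=> s r sge0 rge0; case: (sigma w) s0 => [q| |] //=; last by rewrite !min_l ?leey.
  rewrite lee_fin -!EFin_min/= => q0.
  have h1 := ler_norm (r - s); have h2 := ler_norm (s - r); rewrite distrC in h2.
  have n0 := normr_ge0 (r - s).
  rewrite ler_norml; case: (leP r q) => hr; case: (leP s q) => hs; lra.
- exact: cX.
Qed.

(** The lower limit of the events is an increasing union of tail intersections, each of measure at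
    most [a]. *)
Lemma liminf_measure_le (N : (set T)^nat) (a : \bar R) :
  (forall m, measurable (N m)) -> (forall m, (P (N m) <= a)%E) ->
  exists N' : set T, [/\ measurable N', (P N' <= a)%E &
    forall w, (\forall m \near \oo, N m w) -> N' w].
Proof.
move=> mN Na; pose N' k := \bigcap_(m in [set m | (k <= m)%N]) N m.
have mN' k : measurable (N' k) by apply: bigcap_measurable => //; exists k => /=.
exists (\bigcup_k N' k); split.
- exact: bigcup_measurable.
- have cv : (P \o N') k @[k --> \oo] --> P (\bigcup_k N' k).
    apply: nondecreasing_cvg_mu => //; first exact: bigcup_measurable.
    move=> i j ij; apply/subsetPset => w H m /= jm; apply: H => /=.
    exact: leq_trans jm.
  rewrite -(cvg_lim _ cv)//; apply: lime_le; first by apply/cvg_ex; eexists; exact: cv.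
  apply: nearW => k; rewrite /= (le_trans _ (Na k))// le_measure ?inE//.
  by move=> w; apply => /=.
- by move=> w [k _ H]; exists k => // m /= km; exact: H.
Qed.

(* For [X] stopped at the exit time, the mean is [0] and at most
   [u - v * P (X <= u - v)]. *)
Lemma exit_bound (X D : R -> T -> R) (C u v : R) :
  local_martingale P F X -> (forall w, path_continuous (X ^~ w)) ->
  (forall w, X 0 w = 0) ->
  (forall s, 0 <= s -> F s [set w | 0 < D s w]) ->
  (forall w, path_continuous (D ^~ w)) -> (forall w, D 0 w <= 0) ->
  0 <= u -> 0 < v ->
  (forall w s, 0 <= s -> (forall r, 0 <= r -> r <= s -> D r w <= 0) ->
     `|X s w| <= C /\ X s w <= u) ->
  exists N : set T, [/\ measurable N, (P N <= (u / v)%:E)%E &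
    {ae P, forall w, forall g, exits_at (D ^~ w) g -> X g w <= u - v -> N w}].
Proof.
move=> [aX [sigma [stop incr cvg_sigma mart]]] cX X0 aD cD D0 u0 v0 bX.
pose Y m s w := stopped X (sigma m) s w - X 0 w.
have sigma0 m w : (0 <= sigma m w)%E by case: (stop m).
have YE m s w : Y m s w = stopped X (sigma m) s w by rewrite /Y X0 subr0.
have cY m w : path_continuous (Y m ^~ w).
  have -> : Y m ^~ w = (stopped X (sigma m)) ^~ w by apply/funext => s; rewrite YE.
  exact: path_continuous_stopped.
pose G m w := exit_time (D ^~ w) m.+1%:R.
have G0 m w : 0 <= G m w by apply: exit_time_ge0.
have Gle m w r : 0 <= r -> r <= G m w -> D r w <= 0.
  by move=> r0 rG; apply: (@exit_time_le0 _ (D ^~ w) m.+1%:R).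
(* The bounds hold at every time up to the exit, so also when the localizing time comes first. *)
have bY m w : `|Y m (G m w) w| <= C /\ Y m (G m w) w <= u.
  rewrite YE /stopped; have := sigma0 m w.
  case: (sigma m w) => [q| |] // q0; last first.
    by rewrite min_l ?leey//=; apply: bX => // r; exact: Gle.
  rewrite -EFin_min/=; apply: bX; first by rewrite le_min G0 -lee_fin.
  move=> r r0; rewrite le_min => /andP[rG _]; exact: (Gle m).
have bY1 m w : `|Y m (G m w) w| < C + 1 by have := (bY m w).1; lra.
have os m := optional_stopping filF (mart m) aD (cY m) cD (ltr0Sn R m) (bY1 m).
pose N m := [set w | Y m (G m w) w <= u - v].
have mY m : measurable_fun setT (fun w => Y m (G m w) w) by have [] := os m.
have mN m : measurable (N m).
  have := mY m measurableT _ (measurable_itv `]-oo, (u - v)]%R).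
  by rewrite setTI; congr measurable; apply/seteqP; split => w /=; rewrite in_itv.
have iY m : P.-integrable setT (EFin \o (fun w => Y m (G m w) w)).
  apply: (le_integrable measurableT _ _ (finite_measure_integrable_cst P C measurableT)).
    exact/measurable_EFinP.
  by move=> w _ /=; rewrite lee_fin (le_trans (bY m w).1)// ler_norm.
have PN m : (P (N m) <= (u / v)%:E)%E.
  have i1 := integrable_indic P (mN m).
  have i2 := finite_measure_integrable_cst P u measurableT.
  have : \int[P]_w (v * \1_(N m) w) <= \int[P]_w (u - Y m (G m w) w).
    apply: le_Rintegral => //.
    - exact: integrableZl i1.
    - exact: integrableB i2 (iY m).
    - move=> w _; rewrite indicE; have := (bY m w).2.
      case: (boolP (w \in N m)) => [/set_mem h|_]; rewrite ?mulr1 ?mulr0; last lra.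
      by have : Y m (G m w) w <= u - v := h; lra.
  rewrite RintegralZl// RintegralB//.
  have -> : \int[P]_w Y m (G m w) w = 0.
    have [_ ->] := os m; rewrite (@eq_Rintegral _ _ _ P setT (cst 0)).
      by rewrite Rintegral_cst ?mul0r.
    move=> w _; rewrite /= X0 subr0 /stopped; have := sigma0 m w.
    case: (sigma m w) => [q| |] // q0; last by rewrite min_l ?leey//= X0.
    by rewrite min_l//= X0.
  rewrite Rintegral_cst// (_ : fine (P setT) = 1) ?probability_setT// mulr1 subr0.
  rewrite /Rintegral integral_indic// setIT => h.
  rewrite -(@fineK _ (P (N m))) ?fin_num_measure// lee_fin.
  by rewrite ler_pdivlMr// mulrC.
have [N' [mN' PN' HN']] := liminf_measure_le mN PN.
exists N'; split => //.
apply: filterS cvg_sigma => w cs g [g0 Dg approx] Xg; apply: HN'.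
(* For large [m] the localizing time and the horizon both lie beyond [g], and the stopped value is
   [X g w]. *)
have /cvgeyPge/(_ g) := cs; apply: filter_app; near=> m => gs.
have gm : g <= m.+1%:R.
  by rewrite (@le_trans _ _ m%:R)// ?ler_nat//; near: m; exact: nbhs_infty_ger.
rewrite /N/= YE /stopped /G (exit_timeE (ltr0Sn R m) g0 gm Dg approx).
by rewrite min_l.
Unshelve. all: by end_near. Qed.

End ExitBound.

(** * The almost sure range of the paths *)

Section Unboundedness.
Context {d : measure_display} {T : measurableType d} {R : realType}.
Context {P : probability T R} {F : R -> set (set T)}.
Hypothesis filF : filtration F.
Implicit Types X Q : R -> T -> R.

Lemma ae_not_small (A : T -> Prop) (C : R) :
  (forall k : nat, exists N : set T, [/\ measurable N,
     (P N <= (C / k.+1%:R)%:E)%E & {ae P, forall w, A w -> N w}]) ->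
  {ae P, forall w, ~ A w}.
Proof.
move=> H; pose N k := projT1 (cid (H k)).
have HN k : [/\ measurable (N k), (P (N k) <= (C / k.+1%:R)%:E)%E &
    {ae P, forall w, A w -> N k w}] by exact: projT2 (cid (H k)).
have mI : measurable (\bigcap_k N k).
  by apply: bigcap_measurable => // k _; case: (HN k).
have PI : P (\bigcap_k N k) = 0%E.
  apply/le_anti; rewrite measure_ge0 andbT; apply/lee_addgt0Pr => e e0.
  rewrite add0e; pose k := Num.trunc (C / e).
  have [mk Pk _] := HN k.
  apply: (@le_trans _ _ (P (N k))); first by rewrite le_measure ?inE// => w; apply.
  rewrite (le_trans Pk)// lee_fin ler_pdivrMr// mulrC -ler_pdivrMr//.
  exact/ltW/truncnS_gt.
have ae1 : {ae P, forall w, forall k, A w -> N k w}.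
  by apply: ae_foralln => k; case: (HN k).
have ae2 : {ae P, forall w, ~ (\bigcap_k N k) w}.
  by exists (\bigcap_k N k); split => // w /= /contrapT.
by apply: filterS2 ae1 ae2 => w h1 h2 Aw; apply: h2 => k _; exact: h1.
Qed.

Lemma adaptedU X (U : set (measurableTypeR R)) s : adapted F X -> 0 <= s ->
  measurable U -> F s [set w | U (X s w)].
Proof. by move=> aX s0 mU; exact: (aX s s0 U mU). Qed.

Lemma filtrationU s (A B : set T) : 0 <= s -> F s A -> F s B -> F s (A `|` B).
Proof.
move=> s0; have sF : sigma_algebra setT (F s) by case: filF => + _ _; apply.
move=> FA FB; rewrite -[_ `|` _]setCK setCU.
by apply: (sigma_algebraC sF); apply: (sigma_algebraI sF); exact: (sigma_algebraC sF).
Qed.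

(* [exit_bound] for [X ^+ 2 - Q] and the exit from [`|X| <= a] and [Q <= q]. *)
Lemma local_martingale_exits X Q (a : R) : 0 < a ->
  local_martingale P F X -> (forall w, path_continuous (X ^~ w)) ->
  (forall w, X 0 w = 0) -> is_quadratic_variation P F X Q ->
  {ae P, forall w, Q t w @[t --> +oo] --> +oo} ->
  {ae P, forall w, exists2 s, 0 <= s & a < `|X s w|}.
Proof.
move=> a0 lX cX X0 [aQ cQ Q0 incrQ lY] Qoo.
have {}cQ w : path_continuous (Q ^~ w) by exact/within_path_continuous/cQ.
pose A w := (Q t w @[t --> +oo] --> +oo) /\ forall s, 0 <= s -> `|X s w| <= a.
suff : {ae P, forall w, ~ A w}.
  move=> nA; apply: filterS2 nA Qoo => w nA Qw.
  apply: contrapT => H; apply: nA; split => // s s0.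
  by rewrite leNgt; apply/negP => aX; apply: H; exists s.
apply: (@ae_not_small _ (a ^+ 2)) => k; pose q : R := k.+1%:R.
have q0 : 0 < q by [].
pose D s w := Num.max (`|X s w| - a) (Q s w - q).
have cD w : path_continuous (D ^~ w).
  apply: path_continuous_max; apply/path_continuousP => s s0; apply: cvgB;
    try exact: cvg_cst.
    apply: cvg_norm; exact: (path_continuousP (X ^~ w)).1.
  exact: (path_continuousP (Q ^~ w)).1.
have D0 w : D 0 w <= 0.
  by rewrite /D X0 Q0 normr0 !sub0r ge_max !oppr_le0 !ltW.
have Q_ge0 w s : 0 <= s -> 0 <= Q s w by move=> s0; rewrite -(Q0 w) incrQ.
have [||||||||N [mN PN HN]] := @exit_bound _ _ _ P F filF _ D (a ^+ 2 + q) (a ^+ 2) q lY.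
- move=> w; apply/path_continuousP => s s0; apply: cvgB.
    rewrite expr2; apply: (@cvg_trans _
      (X r w * X r w @[r --> within [set t : R | 0 <= t] (nbhs s)])).
      by under eq_fun do rewrite expr2.
    by apply: cvgM; exact: (path_continuousP (X ^~ w)).1.
  exact: (path_continuousP (Q ^~ w)).1.
- by move=> w; rewrite X0 Q0 expr0n subrr.
- move=> s s0.
  rewrite (_ : mkset _ = [set w | a < `|X s w| ] `|` [set w | q < Q s w]); last first.
    apply/seteqP; split=> w /=; rewrite lt_max !subr_gt0; first by move/orP.
    by case=> ->//; rewrite orbT.
  case: lX => aX _; apply: filtrationU => //.
    have mn := @normr_measurable R setT.
    have := adaptedU aX s0 (mn measurableT _ (measurable_itv `]a, +oo[%R)).
    by congr (F _ _); apply/seteqP; split=> w; rewrite /= in_itv/= andbT; [case|split].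
  have := adaptedU aQ s0 (measurable_itv `]q, +oo[%R).
  by congr (F _ _); apply/seteqP; split=> w; rewrite /= in_itv/= andbT.
- exact: cD.
- exact: D0.
- exact: sqr_ge0.
- exact: q0.
- move=> w s s0 Dle; have := Dle s s0 (lexx s).
  rewrite /D ge_max !subr_le0 => /andP[Xa Qq].
  have Qs0 := Q_ge0 w s s0.
  have X2 : X s w ^+ 2 <= a ^+ 2.
    by rewrite -real_normK ?num_real// ler_pXn2r// nnegrE ltW.
  have X20 := sqr_ge0 (X s w).
  by rewrite ler_norml; split; lra.
exists N; split => //; apply: filterS HN => w HN [Qw Xa].
have [s s0 Qs] : exists2 s, 0 <= s & q < Q s w.
  have := Qw; move/cvgryPgt/(_ q) => [M [_ HM]].
  exists (Num.max 0 (M + 1)); first by rewrite le_max lexx.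
  by apply: HM; rewrite lt_max ltrDl ltr01 orbT.
have Ds : 0 < D s w by rewrite /D lt_max !subr_gt0 Qs orbT.
have [g exg _] := exits_exists (cD w) (D0 w) s0 Ds.
apply: (HN g exg); have [g0 _ approx] := exg.
(* On [A] the exit cannot be through [|X| > a], so [Q] exceeds [q] just after [g]. Hence
   [X ^+ 2 - Q <= a ^+ 2 - q] at [g], an event of probability at most [a ^+ 2 / q]. *)
have Qg : 0 <= Q g w - q.
  apply: (@path_continuous_ge0 _ (fun s => Q s w - q) g _ g0).
    apply/path_continuousP => r r0; apply: cvgB; last exact: cvg_cst.
    exact: (path_continuousP (Q ^~ w)).1.
  move=> e e0; have [r [gr re Dr]] := approx e e0; exists r; split => //.
  have r0 : 0 <= r by lra.
  by move: Dr; rewrite /D lt_max => /orP[|//]; have := Xa r r0; lra.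
have X2 : X g w ^+ 2 <= a ^+ 2.
  by rewrite -real_normK ?num_real// ler_pXn2r ?nnegrE ?Xa// ltW.
lra.
Qed.

(** Gambler's ruin: [exit_bound] with [u = b] and [v = a + b] gives [b / (a + b)]. *)
Lemma local_martingale_ruin X (a b : R) : 0 < a -> 0 < b ->
  local_martingale P F X -> (forall w, path_continuous (X ^~ w)) ->
  (forall w, X 0 w = 0) ->
  exists N : set T, [/\ measurable N, (P N <= (b / a)%:E)%E &
    {ae P, forall w, (exists s, [/\ 0 <= s, X s w < - a &
       forall r, 0 <= r -> r <= s -> X r w <= b]) -> N w}].
Proof.
move=> a0 b0 lX cX X0.
pose D s w := Num.max (X s w - b) (- a - X s w).
have cD w : path_continuous (D ^~ w).
  have cXw := (path_continuousP (X ^~ w)).1 (cX w).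
  apply: path_continuous_max; apply/path_continuousP => s s0; apply: cvgB => //;
    by [exact: cvg_cst|exact: cXw].
have D0 w : D 0 w <= 0.
  by rewrite /D X0 sub0r subr0 ge_max !oppr_le0 !ltW.
have ab0 : 0 < a + b by lra.
have [||||||N [mN PN HN]] := @exit_bound _ _ _ P F filF _ D (a + b) b (a + b) lX cX X0.
- move=> s s0.
  rewrite (_ : mkset _ = [set w | b < X s w] `|` [set w | X s w < - a]); last first.
    apply/seteqP; split=> w /=; rewrite lt_max !subr_gt0; first by move/orP.
    by case=> ->//; rewrite orbT.
  case: lX => aX _; apply: filtrationU => //.
    have := adaptedU aX s0 (measurable_itv `]b, +oo[%R).
    by congr (F _ _); apply/seteqP; split=> w; rewrite /= in_itv/= andbT.
  have := adaptedU aX s0 (measurable_itv `]-oo, (- a)[%R).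
  by congr (F _ _); apply/seteqP; split=> w; rewrite /= in_itv/=.
- exact: cD.
- exact: D0.
- exact: ltW.
- exact: ab0.
- move=> w s s0 Dle; have := Dle s s0 (lexx s).
  by rewrite /D ge_max ler_norml => /andP[]; split; lra.
exists N; split => //.
  rewrite (le_trans PN)// lee_fin ler_pM2l// lef_pV2 ?posrE//; lra.
apply: filterS HN => w HN [s [s0 Xs Xb]].
have Ds : 0 < D s w by rewrite /D lt_max !subr_gt0 Xs orbT.
have [g exg gs] := exits_exists (cD w) (D0 w) s0 Ds.
apply: (HN g exg); have [g0 _ approx] := exg.
suff : 0 <= - a - X g w by lra.
apply: (@path_continuous_ge0 _ (fun s => - a - X s w) g _ g0).
  apply/path_continuousP => r r0; apply: cvgB; first exact: cvg_cst.
  exact: (path_continuousP (X ^~ w)).1.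
(* The cap [s - g] keeps the approximating times before [s], where [X <= b] still holds and only the
   exit through [- a] remains. *)
move=> e e0; pose e' := Num.min e (s - g).
have e'0 : 0 < e' by rewrite lt_min e0 subr_gt0.
have e'e : e' <= e by rewrite ge_min lexx.
have e's : e' <= s - g by rewrite ge_min lexx orbT.
have [r [gr re Dr]] := approx e' e'0.
exists r; split => //; first lra.
have r0 : 0 <= r by lra.
have rs : r <= s by lra.
by move: Dr; rewrite /D lt_max => /orP[|//]; have := Xb r r0 rs; lra.
Qed.

(** A path bounded above by [b] has unbounded modulus and so passes below every [- a], which has
    probability at most [b / a]. *)
Lemma local_martingale_unbounded X Q :
  local_martingale P F X -> (forall w, path_continuous (X ^~ w)) ->
  (forall w, X 0 w = 0) -> is_quadratic_variation P F X Q ->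
  {ae P, forall w, Q t w @[t --> +oo] --> +oo} ->
  {ae P, forall w, forall b : R, exists2 s, 0 <= s & b < X s w}.
Proof.
move=> lX cX X0 qX Qoo.
suff H (k : nat) : {ae P, forall w, ~ forall s, 0 <= s -> X s w <= k.+1%:R}.
  apply: filterS (ae_foralln H) => w {}H b; pose k := Num.trunc b.
  apply: contrapT => nH; apply: (H k) => s s0; rewrite leNgt; apply/negP => kX.
  apply: nH; exists s => //; rewrite (le_lt_trans _ kX)//.
  exact/ltW/truncnS_gt.
pose b : R := k.+1%:R; have b0 : 0 < b by [].
apply: (@ae_not_small _ b) => m; pose a : R := m.+1%:R.
have a0 : 0 < a by [].
have [N [mN PN HN]] := local_martingale_ruin a0 b0 lX cX X0.
exists N; split => //.
have ab0 : 0 < Num.max a b by rewrite lt_max a0.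
apply: filterS2 HN (local_martingale_exits ab0 lX cX X0 qX Qoo) => w HN [s s0 Xs] Xb.
apply: HN; exists s; split => //; last by move=> r r0 _; exact: Xb.
have := Xb s s0; move: Xs; rewrite gt_max -/b -/a => /andP[+ +].
by case: (ger0P (X s w)) => _; lra.
Qed.

(** Ruin with the upper level tending to zero: almost surely no path goes negative while staying
    nonpositive. A path that is not positive up to [t] would therefore be constant there. *)
Lemma local_martingale_positive X :
  local_martingale P F X -> (forall w, path_continuous (X ^~ w)) ->
  (forall w, X 0 w = 0) -> no_constancy P X ->
  {ae P, forall w, forall t : R, 0 < t -> exists s, [/\ 0 <= s, s <= t & 0 < X s w]}.
Proof.
move=> lX cX X0 nX.
pose A (k : nat) w := exists s, [/\ 0 <= s, X s w < - k.+1%:R^-1 &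
       forall r, 0 <= r -> r <= s -> X r w <= 0].
have nA : {ae P, forall w, forall k, ~ A k w}.
  apply: ae_foralln => k; apply: (@ae_not_small _ k.+1%:R) => m.
  have a0 : 0 < k.+1%:R^-1 :> R by rewrite invr_gt0.
  have b0 : 0 < m.+1%:R^-1 :> R by rewrite invr_gt0.
  have [N [mN PN HN]] := local_martingale_ruin a0 b0 lX cX X0.
  exists N; split => //; first by rewrite (le_trans PN)// lee_fin invrK mulrC.
  apply: filterS HN => w HN [s [s0 Xs Xr]]; apply: HN; exists s; split => // r r0 rs.
  by rewrite (le_trans (Xr r r0 rs))// ltW.
apply: filterS2 nA nX => w nA nX t t0; apply: contrapT => H.
have X_le0 s : 0 <= s -> s <= t -> X s w <= 0.
  by move=> s0 st; rewrite leNgt; apply/negP => Xs; apply: H; exists s.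
have [u /andP[u0 ut]] := nX 0 t (lexx 0) t0; rewrite X0 => /eqP; apply.
apply/le_anti; rewrite X_le0//= leNgt; apply/negP => Xu.
apply: (nA (Num.trunc (- X u w)^-1)); exists u; split => //.
  rewrite ltrNr -[ltRHS]invrK ltf_pV2 ?posrE ?invr_gt0 ?oppr_gt0//.
  exact: truncnS_gt.
by move=> r r0 ru; rewrite X_le0// (le_trans ru).
Qed.

Lemma local_martingaleN X : local_martingale P F X ->
  local_martingale P F (fun t w => - X t w).
Proof.
have aN Y : adapted F Y -> adapted F (fun t w => - Y t w).
  move=> aY t t0 U mU; have mo := @oppr_measurable R setT.
  have := aY t t0 _ (mo measurableT _ mU).
  by congr (F _ _); apply/seteqP; split=> w /=; [case|split].
move=> [aX [sigma [stop incr lim mart]]]; split; first exact: aN.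
exists sigma; split => // m; have [aS iS eS] := mart m.
have E : (fun t w => stopped (fun t w => - X t w) (sigma m) t w - - X 0 w) =
    (fun t w => - (stopped X (sigma m) t w - X 0 w)).
  by apply/funext => t; apply/funext => w; rewrite /stopped; ring.
rewrite E; split; first exact: aN.
  by move=> t t0; exact: integrableN (iS t t0).
move=> s t s0 st A FA; have t0 := le_trans s0 st.
have mA : measurable A by case: filF => _ sub _; exact: sub FA.
have NE r : 0 <= r -> \int[P]_(w in A) - (stopped X (sigma m) r w - X 0 w) =
    - \int[P]_(w in A) (stopped X (sigma m) r w - X 0 w).
  move=> r0; rewrite -[RHS]mulN1r -RintegralZl//.
    by apply: eq_Rintegral => w _; rewrite mulN1r.
  by apply: (integrableS measurableT) => //; exact: iS.
by rewrite !NE// (eS s t).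
Qed.

Lemma is_quadratic_variationN X Q : is_quadratic_variation P F X Q ->
  is_quadratic_variation P F (fun t w => - X t w) Q.
Proof.
move=> [aQ cQ Q0 iQ lQ]; split => //.
rewrite (_ : (fun t w => _) = fun t w => X t w ^+ 2 - Q t w)//.
by apply/funext => t; apply/funext => w; rewrite sqrrN.
Qed.

End Unboundedness.

(** * Paths of the embedding *)

Section RunningMax.
Context {T : Type} {R : realType} {B : R -> T -> R}.
Hypothesis cB : continuous_process B.
Lemma running_max_attained w t : 0 <= t ->
  exists c, [/\ 0 <= c, c <= t, B c w = running_max B t w &
    forall s, 0 <= s -> s <= t -> B s w <= running_max B t w].
Proof.
move=> t0.
have cBt : {within `[0, t], continuous (B ^~ w)}.
  apply: continuous_subspaceW (@cB w) => s /=; by rewrite in_itv/= => /andP[].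
have [c] := EVT_max t0 cBt; rewrite in_itv/= => /andP[c0 ct] cmax.
have {}cmax s : 0 <= s -> s <= t -> B s w <= B c w.
  by move=> s0 st; apply: cmax; rewrite in_itv/= s0.
have E : B c w = running_max B t w.
  apply/le_anti/andP; split.
    apply: ub_le_sup; last by exists c => //=; rewrite in_itv/= c0.
    by exists (B c w) => _ [s /=] + <-; rewrite in_itv/= => /andP[]; exact: cmax.
  apply: ge_sup; first by exists (B c w), c => //=; rewrite in_itv/= c0.
  by move=> _ [s /=] + <-; rewrite in_itv/= => /andP[]; exact: cmax.
by exists c; split => // s s0 st; rewrite -E cmax.
Qed.

Lemma running_max_ge w s t : 0 <= s -> s <= t -> B s w <= running_max B t w.
Proof.
by move=> s0 st; have [c [_ _ _]] := running_max_attained w (le_trans s0 st); exact.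
Qed.

Lemma running_max_mono w s t : 0 <= s -> s <= t ->
  running_max B s w <= running_max B t w.
Proof.
move=> s0 st; have [c [c0 cs <- _]] := running_max_attained w s0.
by rewrite running_max_ge// (le_trans cs).
Qed.

Lemma running_max_right w t y :
  path_continuous (B ^~ w) -> 0 <= t -> running_max B t w < y ->
  exists2 h : R, 0 < h & forall s, t <= s -> s < t + h -> running_max B s w < y.
Proof.
move=> pc t0 ty; have e0 : 0 < y - running_max B t w by rewrite subr_gt0.
have [h h0 H] := pc t _ t0 e0; exists h => // s ts sh.
have [c [c0 cs <- _]] := running_max_attained w (le_trans t0 ts).
have bt := running_max_ge w t0 (lexx t).
have [ct|tc] := leP c t; first by rewrite (le_lt_trans _ ty)// running_max_ge.
have close : `|c - t| < h by rewrite gtr0_norm ?subr_gt0//; lra.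
by have := H c c0 close; rewrite ltr_norml; lra.
Qed.

Lemma running_max0 w : B 0 w = 0 -> running_max B 0 w = 0.
Proof.
move=> B0; have [c [c0 c0' <- _]] := running_max_attained w (lexx (0 : R)).
have -> : c = 0 by apply/eqP; rewrite eq_le c0' c0.
exact: B0.
Qed.
End RunningMax.

Lemma le_path_left (R : realType) (f : R -> R) (s t : R) (x : \bar R) :
  path_continuous f -> 0 <= s -> s < t ->
  (forall r, s <= r -> r < t -> (x <= (f r)%:E)%E) -> (x <= (f t)%:E)%E.
Proof.
move=> cf s0 st; case: x => [x| |] H; last by rewrite leNye.
- rewrite lee_fin leNgt; apply/negP => fx.
  have t0 : 0 <= t by lra.
  have e0 : 0 < x - f t by rewrite subr_gt0.
  have [h h0 K] := cf t _ t0 e0; pose r := Num.max s (t - h / 2).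
  have sr : s <= r by rewrite le_max lexx.
  have rh : t - h / 2 <= r by rewrite le_max lexx orbT.
  have rt : r < t by rewrite gt_max; lra.
  have close : `|r - t| < h by rewrite ltr0_norm ?subr_lt0//; lra.
  have := H r sr rt; rewrite lee_fin.
  by have := K r (le_trans s0 sr) close; rewrite ltr_norml; lra.
- by have := H s (lexx s) st; rewrite leye_eq.
Qed.

Definition embedding_time (T : Type) (R : realType)
    (mu : nat -> probability (measurableTypeR R) R) (B : R -> T -> R) (w : T)
    (k : nat) : R :=
  fine (tau mu B k w).

Section Pathwise.
Context {T : Type} {R : realType} {n : nat}.
Context {mu : nat -> probability (measurableTypeR R) R}.
Hypothesis muA : assumption_A n mu.
Context {B : R -> T -> R} {w : T}.
Hypothesis cB : continuous_process B.
Hypothesis B0 : B 0 w = 0.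
Hypothesis B_above : forall b : R, exists2 s, 0 <= s & b < B s w.
Hypothesis B_below : forall b : R, exists2 s, 0 <= s & B s w < b.
Hypothesis B_pos : forall t : R, 0 < t -> exists s, [/\ 0 <= s, s <= t & 0 < B s w].

Local Notation b := (B ^~ w).
Local Notation rm t := (running_max B t w).
Local Notation xi k y := (xi mu k y).

Let pc : path_continuous b.
Proof. by apply: within_path_continuous; exact: cB. Qed.

Let rm0 : rm 0 = 0 := running_max0 cB B0.

Let rm_gt0 t : 0 < t -> 0 < rm t.
Proof.
by move=> /B_pos[s [s0 st Bs]]; rewrite (lt_le_trans Bs)// running_max_ge.
Qed.

Local Notation tm := (embedding_time mu B w).

(** Once the running maximum exceeds 1 the barrier is at least its value at 1, and the path later
    falls below that. *)
Lemma tau_fin k : (k <= n)%N -> tau mu B k w = (tm k)%:E /\ 0 <= tm k.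
Proof.
elim: k => [_|k IH kn]; first by rewrite /embedding_time/= lexx.
have [tE t0] := IH (ltnW kn); rewrite /embedding_time /= tE /=.
case: ifP => _ //=.
set S := ereal_inf _.
have lbS : ((tm k)%:E <= S)%E.
  by apply: le_ereal_inf_tmp => _ [t [kt _] <-].
suff [t St] : exists t : R, (S <= t%:E)%E.
  have Sfin : S \is a fin_num.
    by rewrite fin_numElt (lt_le_trans (ltNyr _) lbS) (le_lt_trans St (ltry _)).
  split; first by rewrite fineK.
  by apply: (le_trans t0); rewrite -lee_fin (fineK Sfin).
have [t1 t10 Bt1] := B_above 1.
pose t2 := Num.max t1 (tm k).
have t1t2 : t1 <= t2 by rewrite le_max lexx.
have kt2 : tm k <= t2 by rewrite le_max lexx orbT.
have t20 : 0 <= t2 by rewrite (le_trans t10).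
have cN : {within `[0, t2], continuous b}.
  apply: continuous_subspaceW (@cB w) => s /=; by rewrite in_itv/= => /andP[].
have [c _ cmin] := EVT_min t20 cN.
have xfin := xi_fin muA kn ltr01.
have [t t0' Bt] := B_below (Num.min (B c w) (fine (xi k.+1 1))).
have t2t : t2 < t.
  rewrite ltNge; apply/negP => tt2; have := cmin t; rewrite in_itv/= t0' tt2 => /(_ isT).
  by move: Bt; rewrite lt_min => /andP[]; lra.
exists t; apply: ereal_inf_lbound; exists t => //; split.
  by rewrite lee_fin; lra.
apply: (@le_trans _ _ (xi k.+1 1)).
  by rewrite -(fineK xfin) lee_fin ltW//; move: Bt; rewrite lt_min => /andP[].
apply: (xi_nondecreasing muA kn ltr01); rewrite (le_trans (ltW Bt1))//.
by apply: running_max_ge => //; lra.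
Qed.

Let tm0 k : (k <= n)%N -> 0 <= tm k.
Proof. by move=> /tau_fin[]. Qed.

(** The infimum is only approached in the last clause, as the barrier along the running maximum may
    jump. *)
Lemma embedding_step k : (k < n)%N ->
  ((B (tm k) w)%:E <= xi k.+1 (rm (tm k)))%E /\ tm k.+1 = tm k \/
  [/\ (xi k.+1 (rm (tm k)) < (B (tm k) w)%:E)%E, tm k <= tm k.+1,
      forall t, tm k <= t -> t < tm k.+1 -> (xi k.+1 (rm t) < (B t w)%:E)%E &
      forall e, 0 < e -> exists t, [/\ tm k.+1 <= t, t < tm k.+1 + e &
        ((B t w)%:E <= xi k.+1 (rm t))%E]].
Proof.
move=> kn; have [tE t0] := tau_fin (ltnW kn); have [tE' t0'] := tau_fin kn.
move: (tE'); rewrite /= tE /=; case: ifPn => [lt|]; last first.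
  by rewrite -leNgt => le [tkE]; left; split => //; exact: esym.
set S := [set t%:E | t in _] => SE; right.
have lbS t : tm k <= t -> ((B t w)%:E <= xi k.+1 (rm t))%E -> tm k.+1 <= t.
  move=> kt Bt; rewrite -lee_fin -SE; apply: ereal_inf_lbound.
  by exists t => //; split; rewrite ?lee_fin.
split => //.
- rewrite -lee_fin -SE; apply: le_ereal_inf_tmp => _ [t [kt _] <-]; exact: kt.
- move=> t kt tk; rewrite ltNge; apply/negP => /(lbS _ kt); lra.
- move=> e e0; have Sfin : ereal_inf S \is a fin_num by rewrite SE.
  have [_ [t [kt Bt] <-]] := lb_ereal_inf_adherent e0 Sfin.
  rewrite SE -EFinD lte_fin => te; exists t; split => //.
  by apply: lbS => //; rewrite -lee_fin.
Qed.

Lemma embedding_time_leS k : (k < n)%N -> tm k <= tm k.+1.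
Proof. by case/embedding_step => [[_ ->]|[]]. Qed.

Lemma embedding_time_mono j k : (j <= k)%N -> (k <= n)%N -> tm j <= tm k.
Proof.
elim: k => [|k IH]; first by rewrite leqn0 => /eqP->.
rewrite leq_eqVlt => /predU1P[->//|jk] kn.
by rewrite (le_trans (IH jk (ltnW kn)))// embedding_time_leS.
Qed.

(** At the first index with a nonzero call at 0, the barrier is below a fixed negative level for
    small positive maxima; stopping at time 0 would contradict the continuity of the path there. *)
Lemma embedding_time_eq0 k : (k <= n)%N -> tm k = 0 ->
  forall j, (j < k)%N -> call mu j.+1 0 = 0.
Proof.
elim: k => [//|k IH] kn tS0.
have tk0 : tm k = 0.
  by apply/le_anti; rewrite tm0 ?(ltnW kn)// andbT -tS0 embedding_time_leS.
have {}IH := IH (ltnW kn) tk0.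
suff ck : call mu k.+1 0 = 0.
  by move=> j; rewrite ltnS leq_eqVlt => /predU1P[->//|]; exact: IH.
have [[+ _]|[lt _ _ approx]] := embedding_step kn.
  by rewrite tk0 rm0 B0; exact: (xi0_ge0_inv muA kn IH).
rewrite tk0 rm0 B0 in lt; rewrite tS0 in approx.
apply/eqP; apply: contraT => c0; have [y y0 xy] := xi_lt0 muA kn IH c0.
have xfin := xi_fin muA kn y0.
have x0 : 0 < - fine (xi k.+1 y) by rewrite oppr_gt0 -lte_fin fineK.
have [h h0 H] := pc (lexx 0) x0.
have r0y : rm 0 < y by rewrite rm0.
have [h' h'0 H'] := running_max_right cB pc (lexx 0) r0y.
have [|t [tge0 th Bt]] := approx (Num.min h h'); first by rewrite lt_min h0.
move: th; rewrite add0r lt_min => /andP[th th'].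
have [t00|tn0] := eqVneq t 0.
  by move: Bt; rewrite t00 rm0 B0 leNgt lt.
have {tge0}t0 : 0 < t by rewrite lt_def tn0.
have rt := H' t (ltW t0) _.
have : (xi k.+1 (rm t) <= xi k.+1 y)%E.
  by apply: (xi_nondecreasing muA) => //; [exact: rm_gt0|apply/ltW/rt; rewrite add0r].
move=> /(le_trans Bt); rewrite -(fineK xfin) lee_fin.
have := H t (ltW t0); rewrite subr0 gtr0_norm// B0 subr0 => /(_ th).
by rewrite ltr_norml; lra.
Qed.

(** Shortly after stopping there are times with the path below the barrier and the maximum still
    below [y]. A stop at time 0 is separate: there the barrier at [y] is [y] itself. *)
Lemma embedding_le k y : (k < n)%N -> 0 < y -> rm (tm k.+1) < y ->
  ((B (tm k.+1) w)%:E <= xi k.+1 y)%E.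
Proof.
move=> kn y0 ry; have tge0 := tm0 kn.
have [t0|tn0] := eqVneq (tm k.+1) 0.
  by rewrite t0 B0 (xi_end muA kn _ y0) ?lee_fin ?ltW// (embedding_time_eq0 kn t0).
have t0 : 0 < tm k.+1 by rewrite lt_def tn0.
have [[le tE]|[_ _ _ approx]] := embedding_step kn.
  rewrite -tE in le; rewrite (le_trans le)// (xi_nondecreasing muA) ?rm_gt0//; exact: ltW.
have xfin := xi_fin muA kn y0; rewrite -(fineK xfin) lee_fin.
apply/ler_addgt0Pr => e e0.
have [h h0 H] := pc tge0 e0.
have [h' h'0 H'] := running_max_right cB pc tge0 ry.
have [|t [tt th Bt]] := approx (Num.min h h'); first by rewrite lt_min h0.
move: th; rewrite -ltrBlDl lt_min => /andP[th th'].
have tpos : 0 < t by rewrite (lt_le_trans t0).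
have rt : rm t < y by apply: H' => //; rewrite -ltrBlDl.
have : (xi k.+1 (rm t) <= xi k.+1 y)%E.
  by apply: (xi_nondecreasing muA) => //; [exact: rm_gt0|exact: ltW].
move=> /(le_trans Bt); rewrite -(fineK xfin) lee_fin.
have := H t (ltW tpos); rewrite ger0_norm ?subr_ge0// => /(_ th).
by rewrite ltr_norml; lra.
Qed.

Lemma embedding_stay k y : (k < n)%N -> 0 < y -> y <= rm (tm k) ->
  ((B (tm k) w)%:E < xi k.+1 y)%E -> tm k.+1 = tm k.
Proof.
move=> kn y0 yr Bx; have [[_ //]|[]] := embedding_step kn.
rewrite ltNge (le_trans (ltW Bx))//; exact: (xi_nondecreasing muA).
Qed.

(** The disjunction is an invariant: from the moment the maximum reaches [y], the running path stays
    above the barrier at [y], hence above [x]. *)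
Lemma embedding_ge k y x : (k < n)%N -> 0 < y -> (x <= xi k.+1 y)%E ->
  rm (tm k) < y \/ (x <= (B (tm k) w)%:E)%E ->
  rm (tm k.+1) < y \/ (x <= (B (tm k.+1) w)%:E)%E.
Proof.
move=> kn y0 xx Hk; have [|yr] := ltP (rm (tm k.+1)) y; [by left|right].
have tk0 := tm0 (ltnW kn); have tS0 := tm0 kn.
have same : tm k.+1 = tm k -> (x <= (B (tm k.+1) w)%:E)%E.
  by move=> tE; rewrite tE in yr *; case: Hk => //; rewrite ltNge yr.
have [[_ /same//]|[_ le above _]] := embedding_step kn.
move: le; rewrite le_eqVlt => /predU1P[/esym/same//|lt].
have reach u : tm k <= u -> u < tm k.+1 -> y <= rm u -> (x <= (B (tm k.+1) w)%:E)%E.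
  move=> ku uS yu; apply: (le_path_left pc (le_trans tk0 ku) uS) => r ur rS.
  rewrite (le_trans xx)// (@le_trans _ _ (xi k.+1 (rm r)))//.
    by rewrite (xi_nondecreasing muA)// (le_trans yu)// running_max_mono// (le_trans tk0).
  by rewrite ltW// above// (le_trans ku).
(* [c] is a time at which the maximum is attained; if it is the stopping time itself, the path
   stands at its maximum, at least [y], and the barrier at [y] is at most [y]. *)
have [c [c0 cS cE _]] := running_max_attained cB w tS0.
have [yk|ky] := leP y (rm (tm k)); first exact: (reach (tm k)).
have kc : tm k < c.
  rewrite ltNge; apply/negP => ck; have := running_max_ge cB w c0 ck.
  by rewrite cE; lra.
move: cS; rewrite le_eqVlt => /predU1P[cS|cS].
  by rewrite (le_trans xx)// (le_trans (xi_le muA kn y0))// lee_fin -cS cE.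
apply: (reach c) => //; first exact: ltW.
by rewrite (le_trans yr)// -cE running_max_ge.
Qed.

Lemma embedding_left_endpoint k : (k <= n)%N -> (0 < n)%N ->
  (left_endpoint (mu n) <= (B (tm k) w)%:E)%E.
Proof.
move=> + n0; elim: k => [_|k IH kn].
  rewrite /embedding_time/= B0 -(prednK n0); apply: (left_endpoint_le0 muA).
  by rewrite prednK.
have {}IH := IH (ltnW kn).
have [[_ ->//]|[_ le above _]] := embedding_step kn.
move: le; rewrite le_eqVlt => /predU1P[<-//|lt].
have tk0 := tm0 (ltnW kn).
(* Starting midway makes the time and hence the maximum positive, as the barrier is controlled only
   there. *)
pose s := (tm k + tm k.+1) / 2.
have s0 : 0 < s by rewrite /s; lra.
have ks : tm k <= s by rewrite /s; lra.
have sS : s < tm k.+1 by rewrite /s; lra.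
apply: (le_path_left pc (ltW s0) sS) => r sr rS.
have r0 := rm_gt0 (lt_le_trans s0 sr).
rewrite (le_trans _ (ltW (above r (le_trans ks sr) rS)))//.
rewrite (le_trans _ (left_endpoint_xi muA kn r0))//.
rewrite -{1}(prednK n0); apply: (left_endpoint_noninc muA); last by rewrite prednK.
by rewrite -ltnS prednK.
Qed.

End Pathwise.

Lemma jmath_idx_above (R : realType) (mu : nat -> probability (measurableTypeR R) R)
    n y k : (jmath_idx mu n y < k)%N -> (k <= n)%N -> (xi mu n y <= xi mu k y)%E.
Proof.
move=> jk; rewrite leq_eqVlt => /predU1P[->//|kn].
by apply: (@last_below_max _ _ n); rewrite kn andbT.
Qed.

(** * Combining the embedding steps along one path *)

Section Contributions.
Context {T : Type} {R : realType} {n : nat}.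
Context {mu : nat -> probability (measurableTypeR R) R}.
Hypotheses (n_gt0 : (0 < n)%N) (muA : assumption_A n mu).
Context {B : R -> T -> R} {w : T}.
Hypothesis cB : continuous_process B.
Hypothesis B0 : B 0 w = 0.
Hypothesis B_above : forall b : R, exists2 s, 0 <= s & b < B s w.
Hypothesis B_below : forall b : R, exists2 s, 0 <= s & B s w < b.
Hypothesis B_pos : forall t : R, 0 < t -> exists s, [/\ 0 <= s, s <= t & 0 < B s w].

Local Notation M k := (M mu B k w).
Local Notation Mbar k := (Mbar mu B k w).

Let time_mono := embedding_time_mono muA cB B_above B_below.

Let Mbar_ge0 k : (k <= n)%N -> 0 <= Mbar k.
Proof.
move=> kn; have [_ t0] := tau_fin muA cB B_above B_below kn.
by rewrite -B0 (running_max_ge cB).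
Qed.

Let Mbar_mono j k : (j <= k)%N -> (k <= n)%N -> Mbar j <= Mbar k.
Proof.
move=> jk kn; have [_ t0] := tau_fin muA cB B_above B_below (leq_trans jk kn).
by apply: (running_max_mono cB) => //; exact: time_mono.
Qed.

Let le_of_Mbar_lt k y : (0 < k <= n)%N -> 0 < y -> Mbar k < y ->
  ((M k)%:E <= xi mu k y)%E.
Proof.
case: k => // k /andP[_ kn].
exact: (embedding_le muA cB B0 B_above B_below B_pos).
Qed.

Let ge_propagates j k y x : (j <= k <= n)%N -> 0 < y ->
  (forall i, (j < i <= k)%N -> (x <= xi mu i y)%E) ->
  Mbar j < y \/ (x <= (M j)%:E)%E -> Mbar k < y \/ (x <= (M k)%:E)%E.
Proof.
move=> + y0; elim: k => [|k IH]; first by rewrite leqn0 => /andP[/eqP->].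
rewrite leq_eqVlt => /andP[/predU1P[->//|jk] kn] xle Hj.
apply: (embedding_ge muA cB B_above B_below) => //; first by apply: xle; rewrite jk leqnn.
apply: IH => //; first by rewrite -ltnS jk ltnW.
by move=> i /andP[ji ik]; apply: xle; rewrite ji ltnW.
Qed.

Lemma contributions y : 0 <= y -> let j := jmath_idx mu n y in
  [/\ (xi mu n y < (M n)%:E)%E -> y <= Mbar n,
      strictly_increasing_at (xi mu n) y ->
        (xi mu n y <= (M n)%:E)%E -> y <= Mbar n,
      j <> 0%N ->
        [/\ 0 < y -> (xi mu n y <= (M j)%:E)%E ->
              (xi mu j y < xi mu n y)%E -> (xi mu n y <= (M n)%:E)%E,
            Mbar j < y -> y <= Mbar n -> (xi mu n y <= (M n)%:E)%E
          & 0 < y -> y <= Mbar j -> ((M j)%:E < xi mu n y)%E ->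
              ((M n)%:E < xi mu n y)%E]
    & strictly_increasing_at (xi mu n) y -> j = 0%N ->
        ((xi mu n y <= (M n)%:E)%E <-> y <= Mbar n)].
Proof.
move=> yge0 j.
have jn : (j < n)%N.
  by rewrite /j /jmath_idx /iota_idx; case: (n) n_gt0 => // m _; exact: last_below_lt.
have above i : (j < i <= n)%N -> (xi mu n y <= xi mu i y)%E.
  by move=> /andP[ji i_n]; exact: jmath_idx_above.
have nn : (0 < n <= n)%N by rewrite n_gt0 leqnn.
have jnn : (j <= n <= n)%N by rewrite ltnW//= leqnn.
have Mbarn := Mbar_ge0 (leqnn n).
have incr : strictly_increasing_at (xi mu n) y ->
    (xi mu n y <= (M n)%:E)%E -> y <= Mbar n.
  move=> inc xM; rewrite leNgt; apply/negP => My.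
  (* The maximum is still below [y'], so the final position is at most the barrier at [y'], strictly
     less than at [y]. *)
  pose y' := (Mbar n + y) / 2.
  have y'0 : 0 < y' by rewrite /y'; lra.
  have My' : Mbar n < y' by rewrite /y'; lra.
  have y'y : y' < y by rewrite /y'; lra.
  have yy1 : y < y + 1 by lra.
  have /andP[xx _] := inc y' (y + 1) (ltW y'0) y'y yy1.
  have := lt_le_trans (le_lt_trans (le_of_Mbar_lt nn y'0 My') xx) xM.
  by rewrite ltxx.
have ge_of_Mbar : 0 < y -> Mbar j < y \/ (xi mu n y <= (M j)%:E)%E ->
    y <= Mbar n -> (xi mu n y <= (M n)%:E)%E.
  move=> y0 Hj yM; have [|//] := ge_propagates jnn y0 above Hj.
  by rewrite ltNge yM.
split => //.
- move=> xM; rewrite leNgt; apply/negP => My.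
  have y0 : 0 < y by lra.
  by have := le_of_Mbar_lt nn y0 My; rewrite leNgt xM.
- move=> j0; have jnn' : (0 < j <= n)%N.
    by rewrite lt0n; apply/andP; split; [exact/eqP|exact: ltnW].
  split.
  + move=> y0 xM xx; apply: ge_of_Mbar => //; first by right.
    (* A maximum below [y] at stage [j] would put the position at or below [xi mu j y]. *)
    apply: (@le_trans _ _ (Mbar j)); last by apply: Mbar_mono => //; exact: ltnW.
    rewrite leNgt; apply/negP => /(le_of_Mbar_lt jnn' y0).
    by rewrite leNgt (lt_le_trans xx).
  + move=> My yM; apply: ge_of_Mbar => //; last by left.
    by rewrite (le_lt_trans _ My)// Mbar_ge0// ltnW.
  + move=> y0 yM Mx.
    (* Below every later barrier at [y] with the maximum already at [y], no further stage moves. *)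
    suff E i : (j <= i <= n)%N -> embedding_time mu B w i = embedding_time mu B w j.
      by rewrite /Defs.M -!/(embedding_time mu B w _) E ?Mx// leqnn ltnW.
    elim: i => [|i IH]; first by rewrite leqn0 => /andP[/eqP->].
    rewrite leq_eqVlt => /andP[/predU1P[->//|ji] i_n].
    have jin : (j <= i <= n)%N by rewrite -ltnS ji ltnW.
    have Ei := IH jin.
    rewrite -Ei; apply: (embedding_stay (y := y) muA cB B_above B_below) => //.
      by rewrite Ei.
    by rewrite Ei (lt_le_trans Mx)// above// ji.
- move=> inc j0; split; first exact: incr.
  move: yge0; rewrite le_eqVlt => /predU1P[yE|y0]; last first.
    apply: ge_of_Mbar => //; left; rewrite j0.
    by have -> : Mbar 0 = 0 by exact: (running_max0 cB B0).
  move=> _.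
  (* At [y = 0], index 0 means that no earlier [xi] is smaller, so [xi mu n 0] is at most the left
     endpoint, above which the path remains. *)
  have := embedding_left_endpoint muA cB B0 B_above B_below B_pos (leqnn n) n_gt0.
  apply: le_trans.
  rewrite -yE in above j0 *; rewrite j0 in above.
  case: (n) n_gt0 muA above => // m _ muA' above'.
  apply: (xi0_le_left_endpoint muA') => // i im; apply: above'.
  by rewrite /= ltnS ltnW.
Qed.

End Contributions.

Unset Implicit Arguments.

(* Two of the three implications for j <> 0 carry [0 < y]: at y = 0 they can fail
   for n = 3, because xi_3 need not be right-continuous at 0 when c_1(0) = c_2(0)
   and c_2 has a kink there, which the hypotheses (about y > 0 only) allow. *)
Theorem lemma3p1 (R : realType) (d : measure_display) (T : measurableType d)
    (P : probability T R) (F : R -> set (set T)) (B Q : R -> T -> R)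
    (n : nat) (mu : nat -> probability (measurableTypeR R) R)
    (usualF : usual_hypotheses P F)
    (cB : continuous_process B)
    (mB : local_martingale P F B)
    (B0 : forall w, B 0 w = 0)
    (qB : is_quadratic_variation P F B Q)
    (Qoo : {ae P, forall w, Q t w @[t --> +oo] --> +oo})
    (nB : no_constancy P B)
    (n_gt0 : (0 < n)%N)
    (muA : assumption_A n mu) :
  {ae P, forall w, forall y : R, 0 <= y ->
    let j := jmath_idx mu n y in
    [/\ (xi mu n y < (M mu B n w)%:E)%E -> y <= Mbar mu B n w,
        strictly_increasing_at (xi mu n) y ->
          (xi mu n y <= (M mu B n w)%:E)%E -> y <= Mbar mu B n w,
        j <> 0%N ->
          [/\ 0 < y -> (xi mu n y <= (M mu B j w)%:E)%E ->
                (xi mu j y < xi mu n y)%E ->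
                (xi mu n y <= (M mu B n w)%:E)%E,
              Mbar mu B j w < y -> y <= Mbar mu B n w ->
                (xi mu n y <= (M mu B n w)%:E)%E
            & 0 < y ->
                y <= Mbar mu B j w -> ((M mu B j w)%:E < xi mu n y)%E ->
                ((M mu B n w)%:E < xi mu n y)%E]
      & strictly_increasing_at (xi mu n) y -> j = 0%N ->
          ((xi mu n y <= (M mu B n w)%:E)%E <-> y <= Mbar mu B n w)]}.
Proof.
have [filF _ _] := usualF.
have pcB w : path_continuous (B ^~ w) by apply: within_path_continuous; exact: cB.
have pcN w : path_continuous (fun t => - B t w).
  apply/path_continuousP => s s0; apply: cvgN.
  exact: (path_continuousP (B ^~ w)).1.
have N0 w : - B 0 w = 0 by rewrite B0 oppr0.
have sup_oo := local_martingale_unbounded filF mB pcB B0 qB Qoo.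
have inf_oo := local_martingale_unbounded filF (local_martingaleN filF mB)
  pcN N0 (is_quadratic_variationN qB) Qoo.
have pos := local_martingale_positive filF mB pcB B0 nB.
apply: filterS3 sup_oo inf_oo pos => w above below pos y y0.
apply: contributions => // b; have [s s0 Bs] := below (- b).
by exists s => //; rewrite -ltrN2.
Qed.
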